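(* Let $n\ge1$, let $\nu>0$, let $\Gamma$ be a full-rank lattice in $\mathbb{C}^n$, and let $\chi:\Gamma\to U(1)$ be a map such that $\chi(\gamma_1+\gamma_2)=\chi(\gamma_1)\chi(\gamma_2)e^{i\nu\omega(\gamma_1,\gamma_2)}$ for all $\gamma_1,\gamma_2\in\Gamma$. Then the space of holomorphic functions $g$ on $\mathbb{C}^n$ satisfying $$g(z+\gamma)=\chi(\gamma)e^{\frac{\nu}{2}|\gamma|^2+\nu\langle z,\gamma\rangle}g(z)\qquad(z\in\mathbb{C}^n,\ \gamma\in\Gamma)\qquad( * )$$ is equal to the null space of the differential operator $$\Delta^\nu_{\Gamma,\chi}=\sum_{j=1}^n\Big(-\frac{\partial^2}{\partial z_j\partial\bar z_j}+\nu\bar z_j\frac{\partial}{\partial\bar z_j}\Big)$$ acting on the space $\mathcal{G}^\nu_{\Gamma,\chi}$ of all $\mathcal{C}^\infty$ functions $g:\mathbb{C}^n\to\mathbb{C}$ satisfying $( * )$.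
   Context: $\mathbb{C}^n$ carries the Hermitian form $\langle z,w\rangle=z_1\bar w_1+\cdots+z_n\bar w_n$, with $|z|^2=\langle z,z\rangle$ and $\omega(z,w)=\mathrm{Im}\langle z,w\rangle$. A full-rank lattice $\Gamma$ is a discrete subgroup of rank $2n$ of $(\mathbb{C}^n,+)$. $U(1)=\{\lambda\in\mathbb{C}:|\lambda|=1\}$. *)

(* Defs.v *)
(* The complex field is R[i] for R : realType; C^n is the space of row vectors
   'rV[R[i]]_n. *)
From HB Require Import structures.
From mathcomp Require Import all_boot all_order all_algebra.
From mathcomp Require Import all_classical all_reals all_analysis.
From mathcomp Require Import complex.
Set Implicit Arguments.
Unset Strict Implicit.
Unset Printing Implicit Defensive.
Import Order.TTheory GRing.Theory Num.Theory.
Import numFieldNormedType.Exports.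
Local Open Scope classical_set_scope.
Local Open Scope ring_scope.
Local Open Scope complex_scope.

(* The topology and norm of R[i] are those that every numFieldType F carries
   on F^o. With this instance, 'rV[R[i]]_n inherits its usual topology and is a
   normed space over R[i] (with the sup norm). *)
HB.instance Definition _ (R : rcfType) := NormedModule.copy R[i] R[i]^o.

Definition U1 {R : realType} : set R[i] := [set l | `|l| = 1].

Definition expc {R : realType} (x : R[i]) : R[i] :=
  let: a +i* b := x in (expR a * cos b) +i* (expR a * sin b).

Section ComplexSpace.
Variables (R : realType) (n : nat).
Local Notation C := R[i].
Local Notation V := 'rV[R[i]]_n.
Implicit Types (z w v : V) (g : V -> C) (G : set V).

Definition hdot z w : C := \sum_(j < n) z 0 j * conjc (w 0 j).

Definition hnormsq z : C := hdot z z.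

Definition omega z w : R := complex.Im (hdot z w).

Definition Zfree r (e : 'I_r -> V) : Prop :=
  forall c : 'I_r -> int, \sum_(i < r) e i *~ c i = 0 -> forall i, c i = 0.

(* r is the rank of the abelian group G: the maximal size of a Z-linearly
   independent family of elements of G. *)
Definition has_rank G r : Prop :=
  (exists2 e : 'I_r -> V, (forall i, G (e i)) & Zfree e) /\
  (forall e : 'I_r.+1 -> V, (forall i, G (e i)) -> ~ Zfree e).

Definition full_rank_lattice G : Prop :=
  [/\ G 0,
      (forall x y, G x -> G y -> G (x - y)),
      G `<=` isolated G
    & has_rank G (2 * n)%N].

(* Differentiability over the scalar field R[i], i.e. with an R[i]-linear
   differential, at every point. *)
Definition holomorphic g : Prop := forall z, differentiable g z.

(* Derivatives of g, as a function of 2n real variables, along the real line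
   z + R v. *)
Definition rderivable g v z : Prop :=
  derivable (fun t : R => complex.Re (g (z + t%:C *: v))) 0 1 /\
  derivable (fun t : R => complex.Im (g (z + t%:C *: v))) 0 1.

Definition rderive v g : V -> C := fun z =>
  derive1 (fun t : R => complex.Re (g (z + t%:C *: v))) 0 +i*
  derive1 (fun t : R => complex.Im (g (z + t%:C *: v))) 0.

(* With z_j = x_j + i y_j, the real coordinate directions of x_j and y_j. *)
Definition dirx (j : 'I_n) : V := delta_mx 0 j.
Definition diry (j : 'I_n) : V := (0 +i* 1) *: delta_mx 0 j.

(* Real class C^k: all iterated partial derivatives with respect to
   x_1, y_1, ..., x_n, y_n up to order k exist everywhere and are continuous. *)
Fixpoint class_C (k : nat) g : Prop :=
  continuous g /\
  match k with
  | 0%N => True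
  | k'.+1 => forall j : 'I_n,
      [/\ (forall z, rderivable g (dirx j) z),
          (forall z, rderivable g (diry j) z),
          class_C k' (rderive (dirx j) g)
        & class_C k' (rderive (diry j) g)]
  end.

Definition smooth g : Prop := forall k, class_C k g.

(* Wirtinger operators d/dz_j and d/d\bar z_j. *)
Definition dz (j : 'I_n) g : V -> C := fun z =>
  2^-1 * (rderive (dirx j) g z - (0 +i* 1) * rderive (diry j) g z).
Definition dzbar (j : 'I_n) g : V -> C := fun z =>
  2^-1 * (rderive (dirx j) g z + (0 +i* 1) * rderive (diry j) g z).

Definition Delta (nu : R) g : V -> C := fun z =>
  \sum_(j < n) (- dz j (dzbar j g) z + nu%:C * conjc (z 0 j) * dzbar j g z).

(* Only the values of chi on G are used. *)
Definition quasiperiodic (nu : R) G (chi : V -> C) g : Prop :=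
  forall z w, G w ->
    g (z + w) =
    chi w * expc ((nu / 2)%:C * hnormsq w + nu%:C * hdot z w) * g z.

Definition Gspace (nu : R) G (chi : V -> C) : set (V -> C) :=
  [set g | smooth g /\ quasiperiodic nu G chi g].

End ComplexSpace.

(* Main.v *)
Require Import Defs.
From HB Require Import structures.
From mathcomp Require Import all_boot all_order all_algebra.
From mathcomp Require Import all_classical all_reals all_analysis.
From mathcomp Require Import complex ring lra.
Set Implicit Arguments.
Unset Strict Implicit.
Unset Printing Implicit Defensive.
Import Order.TTheory GRing.Theory Num.Theory.
Import numFieldNormedType.Exports.
Local Open Scope classical_set_scope.
Local Open Scope ring_scope.
Local Open Scope complex_scope.

(** The null space consists of the smooth quasiperiodic functions g that are
    killed by every Cauchy-Riemann operator [dzbar j]; both inclusions compare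
    this condition with its two neighbours, pointwise complex differentiability
    and the second-order equation [Delta nu g = 0].

    If g is complex differentiable at every point of C^n, then [dzbar j g = 0],
    so [Delta nu g = 0] is immediate once g is known to be smooth.  Since
    nothing is assumed on the continuity of the differential, smoothness has to
    come from a Cauchy estimate.  For f entire of one variable put
    F(s + it) = (f(a + e^(s + it)) - f(a)) e^(-(s + it)).  This function is
    entire and 2 pi i-periodic, so its mean over a vertical period does not
    depend on s ([periodic_mean_le], proved by Goursat's bisection
    [bisection_eq0]).  The mean tends to f'(a) as s tends to -oo and is at most
    2 M / r at s = ln r, where M bounds f on the disc of radius r: this is
    [cauchy_estimate].  Applied on complex lines to g, and then to
    g(. + h) - g, it bounds the differential of g and makes it locally
    Lipschitz; the difference quotients of g therefore converge locally
    uniformly to a partial derivative, and a locally uniform limit of entire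
    functions is entire ([weierstrass]).  So partial derivatives of entire
    functions are entire ([entire_partial]), and induction gives smoothness.

    Conversely let g be smooth and quasiperiodic with [Delta nu g = 0], and
    consider the vector field X_j = e^(-nu |z|^2) conj(g) dzbar_j g.  The
    automorphy factor has modulus squared e^(nu |w|^2 + 2 nu Re <z, w>), which
    the weight cancels, so X is Gamma-periodic; and
      sum_j dX_j / dz_j
        = e^(-nu |z|^2) (sum_j |dzbar_j g|^2 - conj(g) Delta g)
        = e^(-nu |z|^2) sum_j |dzbar_j g|^2  >=  0.
    The divergence of a periodic field has mean zero over the torus, hence
    vanishes identically when it is nonnegative ([periodic_divergence_eq0]);
    so [dzbar j g = 0] for all j, and a C^1 function that satisfies the
    Cauchy-Riemann equations is complex differentiable
    ([cauchy_riemann_cgrad]).  The mean is taken as a Riemann sum over the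
    finite group ((1/N) Lambda) / Lambda, where Lambda is generated by 2n
    independent vectors of Gamma; difference quotients of periodic functions
    sum exactly to zero over it.  This uses that Gamma spans C^n over the reals
    ([lattice_span]), which follows from discreteness and the rank by
    Dirichlet's simultaneous approximation. *)

(** * Goursat's theorem as a conservation law *)
Lemma primitive_exists (R : realType) (phi : R -> R) (a b : R) :
  continuous phi ->
  exists Phi : R -> R, forall x, a < x -> x < b -> is_derive x 1 Phi (phi x).
Proof.
move=> cphi.
exists (fun x => (\int[lebesgue_measure]_(t in `[a, x]) phi t)%R) => x ax xb.
have iphi : lebesgue_measure.-integrable `[a, b]%classic (EFin \o phi).
  apply: continuous_compact_integrable; first exact: segment_compact.
  exact: continuous_subspaceT.
have [D1 D2] := @continuous_FTC1_closed R phi a x b xb iphi ax (cphi x).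
rewrite derive1E in D2; exact: (DeriveDef D1 D2).
Qed.

(** The only form in which integrals are estimated below: primitives F and P
    replace the integrals of f and p over [a, b]. *)
Lemma increment_le (R : realType) (F f P p : R -> R) (a b e : R) : a <= b ->
  (forall x, a <= x <= b -> is_derive x 1 F (f x)) ->
  (forall x, a <= x <= b -> is_derive x 1 P (p x)) ->
  (forall x, a <= x <= b -> `|f x - p x| <= e) ->
  `|(F b - F a) - (P b - P a)| <= e * (b - a).
Proof.
move=> ab dF dP fp.
have dFP x : a <= x <= b -> is_derive x 1 (F - P) (f x - p x).
  by move=> xab; apply: is_deriveB; [exact: dF|exact: dP].
have [c cab E] : exists2 c, c \in `[a, b] &
    (F - P) b - (F - P) a = (f c - p c) * (b - a).
  apply: MVT_segment => //.
    by move=> x; rewrite in_itv/= => /andP[ax xb]; apply: dFP; rewrite !ltW.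
  apply: derivable_within_continuous => x; rewrite in_itv/= => xab.
  exact: (@ex_derive _ _ _ _ _ _ _ (dFP x xab)).
have -> : F b - F a - (P b - P a) = (f c - p c) * (b - a).
  by rewrite -E !fctE; ring.
rewrite normrM (ger0_norm (_ : 0 <= b - a)) ?subr_ge0//.
by rewrite ler_wpM2r ?subr_ge0// fp//; rewrite in_itv in cab.
Qed.

Section Bisection.
Variables (R : realType) (mu : R -> R -> R -> R -> R).
Hypothesis mu_x : forall x1 x2 x3 y1 y2,
  mu x1 x3 y1 y2 = mu x1 x2 y1 y2 + mu x2 x3 y1 y2.
Hypothesis mu_y : forall x1 x2 y1 y2 y3,
  mu x1 x2 y1 y3 = mu x1 x2 y1 y2 + mu x1 x2 y2 y3.

(** The values of mu on the four quarters add up to its value on the rectangle,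
    so they cannot all be below a quarter of it. *)
Lemma bisect_step (x y w h : R) : exists q : R * R,
  [/\ q.1 = x \/ q.1 = x + w / 2, q.2 = y \/ q.2 = y + h / 2 &
  `|mu x (x + w) y (y + h)| <=
    4 * `|mu q.1 (q.1 + w / 2) q.2 (q.2 + h / 2)| ].
Proof.
set m := fun u v => `|mu u (u + w / 2) v (v + h / 2)|.
have E : `|mu x (x + w) y (y + h)| <=
   m x y + m x (y + h / 2) + (m (x + w / 2) y + m (x + w / 2) (y + h / 2)).
  rewrite (mu_x _ (x + w / 2)) (mu_y x _ _ (y + h / 2))
          (mu_y (x + w / 2) _ _ (y + h / 2)).
  rewrite /m.
  have -> : x + w / 2 + w / 2 = x + w by field.
  have -> : y + h / 2 + h / 2 = y + h by field.
  apply: le_trans (ler_normD _ _) _.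
  by apply: lerD; exact: ler_normD.
apply: contrapT => /forallNP H.
have {}H u v : (u = x \/ u = x + w / 2) -> (v = y \/ v = y + h / 2) ->
    4 * m u v < `|mu x (x + w) y (y + h)|.
  move=> Hu Hv; rewrite ltNge; apply/negP => K.
  by apply: (H (u, v)); split.
have H1 := H x y (or_introl erefl) (or_introl erefl).
have H2 := H x _ (or_introl erefl) (or_intror erefl).
have H3 := H _ y (or_intror erefl) (or_introl erefl).
have H4 := H _ _ (or_intror erefl) (or_intror erefl).
lra.
Qed.

(** Goursat's bisection: if mu did not vanish, nested quarters would keep
    |mu| >= |mu a b c d| / 4^k while their diameters are of order 2^-k, which
    contradicts the o(diameter^2) bound at the limit point. *)
Lemma bisection_eq0 (a b c d : R) : a <= b -> c <= d ->
  (forall x y, a <= x <= b -> c <= y <= d -> forall e : R, 0 < e ->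
     exists2 dl : R, 0 < dl & forall x1 x2 y1 y2,
      a <= x1 -> x1 <= x <= x2 -> x2 <= b ->
      c <= y1 -> y1 <= y <= y2 -> y2 <= d ->
      x2 - x1 < dl -> y2 - y1 < dl ->
      `|mu x1 x2 y1 y2| <= e * ((x2 - x1) + (y2 - y1)) ^+ 2) ->
  mu a b c d = 0.
Proof.
move=> ab cd loc.
(* Width and height of the rectangle of generation k; [P k] is its lower left
   corner. *)
pose w k := (b - a) / 2 ^+ k; pose h k := (d - c) / 2 ^+ k.
have w0 k : 0 <= w k by rewrite divr_ge0 ?subr_ge0// exprn_ge0.
have h0 k : 0 <= h k by rewrite divr_ge0 ?subr_ge0// exprn_ge0.
have p2 k : (2 : R) ^+ k != 0 by rewrite expf_neq0.
have wS k : w k.+1 = w k / 2 by rewrite /w exprS; field; rewrite p2.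
have hS k : h k.+1 = h k / 2 by rewrite /h exprS; field; rewrite p2.
pose step k (p q : R * R) :=
  [/\ q.1 = p.1 \/ q.1 = p.1 + w k / 2, q.2 = p.2 \/ q.2 = p.2 + h k / 2 &
  `|mu p.1 (p.1 + w k) p.2 (p.2 + h k)| <=
    4 * `|mu q.1 (q.1 + w k.+1) q.2 (q.2 + h k.+1)| ].
have /boolp.choice[nxt Hn] : forall kp : nat * (R * R),
    exists q, step kp.1 kp.2 q.
  by move=> [k [x y]]; rewrite /step wS hS; exact: bisect_step.
pose P := fix P k := if k is k'.+1 then nxt (k', P k') else (a, c).
have PS k : step k (P k) (P k.+1) by exact: (Hn (k, P k)).
have big k : `|mu a b c d| <=
    4 ^+ k * `|mu (P k).1 ((P k).1 + w k) (P k).2 ((P k).2 + h k)|.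
  elim: k => [|k IH].
    rewrite mul1r /= /w /h expr0 !divr1.
    by rewrite !subrKC.
  apply: le_trans IH _; rewrite exprSr -mulrA ler_wpM2l ?exprn_ge0//.
  by have [] := PS k.
have mon1 k : (P k).1 <= (P k.+1).1 /\
    (P k.+1).1 + w k.+1 <= (P k).1 + w k.
  by have [[->|->] _ _] := PS k; rewrite wS; have := w0 k; lra.
have mon2 k : (P k).2 <= (P k.+1).2 /\
    (P k.+1).2 + h k.+1 <= (P k).2 + h k.
  by have [_ [->|->] _] := PS k; rewrite hS; have := h0 k; lra.
(* Nested closed intervals share the supremum of their left endpoints. *)
have nested (p l : nat -> R) : (forall k, 0 <= l k) ->
   (forall k, p k <= p k.+1 /\ p k.+1 + l k.+1 <= p k + l k) ->
   exists z, forall k, p k <= z <= p k + l k.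
  move=> l0 mon.
  have m1 j i : p j <= p (i + j)%N.
    by elim: i => // i IH; rewrite addSn (le_trans IH)//; case: (mon (i + j)%N).
  have m2 j i : p (i + j)%N + l (i + j)%N <= p j + l j.
    by elim: i => // i IH; rewrite addSn (le_trans _ IH)//; case: (mon (i + j)%N).
  have ub k : ubound (range p) (p k + l k).
    move=> _ [j _ <-]; have := m1 j k; have := m2 k j; have := l0 (j + k)%N.
    by rewrite (addnC k j); lra.
  have hs : has_sup (range p).
    by split; [exists (p 0%N), 0%N|exists (p 0%N + l 0%N); exact: ub].
  exists (sup (range p)) => k; apply/andP; split.
    by apply: ub_le_sup; [case: hs|exists k].
  by apply: ge_sup; [case: hs|exact: ub].
have [x Hx] := nested _ _ w0 mon1.
have [y Hy] := nested _ _ h0 mon2.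
have in1 k : a <= (P k).1 /\ (P k).1 + w k <= b.
  elim: k => [|k IH]; first by rewrite /= /w expr0; lra.
  by have := mon1 k; lra.
have in2 k : c <= (P k).2 /\ (P k).2 + h k <= d.
  elim: k => [|k IH]; first by rewrite /= /h expr0; lra.
  by have := mon2 k; lra.
have xab : a <= x <= b by have := Hx 0%N; have := in1 0%N; lra.
have ycd : c <= y <= d by have := Hy 0%N; have := in2 0%N; lra.
apply/eqP; rewrite -normr_eq0; apply/negP => /negP m0.
have {m0}mp : 0 < `|mu a b c d| by rewrite lt_def m0 normr_ge0.
set M := `|mu a b c d| in mp big *.
set S := (b - a) + (d - c).
have S0 : 0 <= S by rewrite /S; lra.
have e0 : 0 < M / (2 * (S ^+ 2 + 1)).
  by rewrite divr_gt0// mulr_gt0// ltr_wpDl// exprn_ge0.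
have [dl dl0 Hdl] := loc x y xab ycd _ e0.
have [k Hk] : exists k : nat, S / 2 ^+ k < dl.
  exists (Num.bound (S / dl)).
  rewrite ltr_pdivrMr ?exprn_gt0// -ltr_pdivrMl// mulrC.
  apply: lt_le_trans (archi_boundP _) _; first by rewrite divr_ge0// ltW.
  by rewrite -natrX ler_nat ltnW// ltn_expl.
have wd : w k < dl.
  apply: le_lt_trans Hk; rewrite /w ler_pM2r ?invr_gt0 ?exprn_gt0//.
  by rewrite /S; lra.
have hd : h k < dl.
  apply: le_lt_trans Hk; rewrite /h ler_pM2r ?invr_gt0 ?exprn_gt0//.
  by rewrite /S; lra.
have [i1 i2] := in1 k; have [j1 j2] := in2 k.
have sw (u v : R) : u + v - u = v by ring.
have := Hdl _ _ _ _ i1 (Hx k) i2 j1 (Hy k) j2.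
rewrite !sw => /(_ wd hd) K.
have K2 : M <= M / (2 * (S ^+ 2 + 1)) * S ^+ 2.
  apply: le_trans (big k) _.
  apply: le_trans (ler_wpM2l _ K) _; first exact: exprn_ge0.
  rewrite mulrCA ler_wpM2l ?(ltW e0)//.
  rewrite le_eqVlt; apply/orP; left; apply/eqP.
  have -> : w k + h k = S / 2 ^+ k by rewrite /w /h /S -mulrDl.
  have -> : (4 : R) ^+ k = (2 ^+ k) ^+ 2.
    by rewrite -exprM mulnC exprM; congr (_ ^+ _); ring.
  by rewrite expr_div_n mulrC divfK ?expf_neq0.
move: K2; rewrite mulrAC ler_pdivlMr; last first.
  by rewrite mulr_gt0// ltr_wpDl// exprn_ge0.
have : 0 <= S ^+ 2 by exact: exprn_ge0.
by nra.
Qed.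
End Bisection.

(** A pair (u, v) with du/dx = dv/dy: the flow of the field (u, -v) through
    small rectangles is of smaller order than their area, by differentiability
    alone. *)
Section Conservation.
Variables (R : realType) (u v : R -> R -> R).
Hypothesis uv_diff : forall x y, exists al be ga : R, forall e : R, 0 < e ->
  exists2 dl : R, 0 < dl & forall h k, `|h| < dl -> `|k| < dl ->
    `|u (x + h) (y + k) - u x y - (al * h + be * k)| <= e * (`|h| + `|k|) /\
    `|v (x + h) (y + k) - v x y - (ga * h + al * k)| <= e * (`|h| + `|k|).

Let cont (f : R -> R) :
  (forall x e : R, 0 < e -> exists2 dl : R, 0 < dl & forall h, `|h| < dl ->
     `|f (x + h) - f x| <= e) -> continuous f.
Proof.
move=> H x; apply/cvgrPdist_le => e e0; have [dl dl0 Hd] := H x e e0.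
near=> t; rewrite distrC; have -> : t = x + (t - x) by ring.
rewrite Hd// distrC; near: t.
Unshelve. all: by end_near. Qed.

Let small (a e : R) : 0 < e -> exists2 dl : R, 0 < dl &
  forall h, `|h| < dl -> `|a * h| + `|h| <= e.
Proof.
move=> e0; exists (e / (`|a| + 1)); first by rewrite divr_gt0// ltr_wpDl.
move=> h; rewrite ltr_pdivlMr ?ltr_wpDl// normrM.
by have := normr_ge0 h; nra.
Qed.

Lemma u_cont x : continuous (u x).
Proof.
apply: cont => y e e0; have [al [be [ga H]]] := uv_diff x y.
have [d1 d10 H1] := H 1 ltr01; have [d2 d20 H2] := small be e0.
exists (Num.min d1 d2); first by rewrite lt_min d10.
move=> k; rewrite lt_min => /andP[k1 k2].
have [||+ _] := H1 0 k => //; first by rewrite normr0.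
have := H2 _ k2.
rewrite addr0 mulr0 normr0 add0r mul1r !add0r.
have := ler_normD (u x (y + k) - u x y - be * k) (be * k).
by rewrite subrK; lra.
Qed.

Lemma v_cont y : continuous (v^~ y).
Proof.
apply: cont => x e e0; have [al [be [ga H]]] := uv_diff x y.
have [d1 d10 H1] := H 1 ltr01; have [d2 d20 H2] := small ga e0.
exists (Num.min d1 d2); first by rewrite lt_min d10.
move=> k; rewrite lt_min => /andP[k1 k2].
have [||_ +] := H1 k 0 => //; first by rewrite normr0.
have := H2 _ k2.
rewrite addr0 mulr0 normr0 addr0 mul1r !addr0.
have := ler_normD (v (x + k) y - v x y - ga * k) (ga * k).
by rewrite subrK; lra.
Qed.

(** By the conservation law du/dx = dv/dy and periodicity of v in y, the
    integral of u(x, .) over a period does not depend on x.  Comparing bounds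
    of u on two verticals avoids speaking of the integral itself. *)
Lemma periodic_mean_le (T : R) : 0 < T ->
  (forall x y, v x (y + T) = v x y) ->
  forall s0 s1 A B, s0 <= s1 ->
  (forall y, A <= u s0 y) -> (forall y, u s1 y <= B) -> A <= B.
Proof.
move=> T0 per s0 s1 A B s01 HA HB.
have /boolp.choice[U HU] x := @primitive_exists R _ (-1) (T + 1) (@u_cont x).
have /boolp.choice[W HW] y := @primitive_exists R _ (s0 - 1) (s1 + 1) (@v_cont y).
(* Outward flow through the boundary of a rectangle, written with primitives
   of u along verticals and of v along horizontals, so that it is additive. *)
pose mu x1 x2 y1 y2 := (U x2 y2 - U x2 y1) - (U x1 y2 - U x1 y1)
   - (W y2 x2 - W y2 x1) + (W y1 x2 - W y1 x1).
have mu0 : mu s0 s1 0 T = 0.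
  apply: bisection_eq0 => //; [by rewrite /mu => *; ring..|exact: ltW|].
  move=> x y xs yT e e0; have [al [be [ga H]]] := uv_diff x y.
  have e4 : 0 < e / 4 by rewrite divr_gt0.
  have [dl dl0 Hd] := H (e / 4) e4; exists dl => //.
  move=> x1 x2 y1 y2 sx1 xx x2s sy1 yy y2s dx dy.
  set D := (x2 - x1) + (y2 - y1).
  (* On the small rectangle u and v are replaced by their first-order
     expansions, whose total flow is zero because the coefficient [al] is
     shared; each side then contributes an error e / 4 times D^2. *)
  have Uest z : x1 <= z <= x2 -> `|(U z y2 - U z y1) -
     ((u x y + al * (z - x)) * (y2 - y1) +
        be * ((y2 - y) ^+ 2 - (y1 - y) ^+ 2) / 2)| <= e / 4 * D * (y2 - y1).
    move=> xz.
    pose P t := (u x y + al * (z - x)) * t + be / 2 * (t - y) ^+ 2.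
    have -> : (u x y + al * (z - x)) * (y2 - y1) +
        be * ((y2 - y) ^+ 2 - (y1 - y) ^+ 2) / 2 = P y2 - P y1.
      by rewrite /P; ring.
    apply: (@increment_le _ _ (u z) P
      (fun t => (u x y + al * (z - x)) + be * (t - y))); first lra.
    - by move=> t ty; apply: HU; lra.
    - move=> t ty; apply: is_derive_eq.
      by rewrite /GRing.scale/=; field.
    move=> t ty; have [||+ _] := Hd (z - x) (t - y).
    + by rewrite ltr_norml; lra.
    + by rewrite ltr_norml; lra.
    rewrite !subrKC => K.
    rewrite (_ : u z t - _ = u z t - u x y - (al * (z - x) + be * (t - y)));
      last by ring.
    apply: le_trans K _; rewrite ler_wpM2l ?(ltW e4)//.
    by rewrite lerD// ler_norml; lra.
  have West z : y1 <= z <= y2 -> `|(W z x2 - W z x1) -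
     ((v x y + al * (z - y)) * (x2 - x1) +
        ga * ((x2 - x) ^+ 2 - (x1 - x) ^+ 2) / 2)| <= e / 4 * D * (x2 - x1).
    move=> xz.
    pose P t := (v x y + al * (z - y)) * t + ga / 2 * (t - x) ^+ 2.
    have -> : (v x y + al * (z - y)) * (x2 - x1) +
        ga * ((x2 - x) ^+ 2 - (x1 - x) ^+ 2) / 2 = P x2 - P x1.
      by rewrite /P; ring.
    apply: (@increment_le _ _ (v^~ z) P
      (fun t => (v x y + al * (z - y)) + ga * (t - x))); first lra.
    - by move=> t ty; apply: HW; lra.
    - move=> t ty; apply: is_derive_eq.
      by rewrite /GRing.scale/=; field.
    move=> t ty; have [||_ +] := Hd (t - x) (z - y).
    + by rewrite ltr_norml; lra.
    + by rewrite ltr_norml; lra.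
    rewrite !subrKC => K.
    rewrite (_ : v t z - _ = v t z - v x y - (ga * (t - x) + al * (z - y)));
      last by ring.
    apply: le_trans K _; rewrite ler_wpM2l ?(ltW e4)//.
    by rewrite lerD// ler_norml; lra.
  have x12 : x1 <= x2 by lra.
  have y12 : y1 <= y2 by lra.
  have := Uest x2; have := Uest x1; have := West y2; have := West y1.
  rewrite !lexx x12 y12 /=.
  move=> /(_ isT) W1 /(_ isT) W2 /(_ isT) U1 /(_ isT) U2.
  have Dx : e / 4 * D * (x2 - x1) <= e / 4 * D ^+ 2.
    rewrite expr2 mulrA ler_wpM2l//; last by rewrite /D; lra.
    by rewrite mulr_ge0 ?(ltW e4)// /D; lra.
  have Dy : e / 4 * D * (y2 - y1) <= e / 4 * D ^+ 2.
    rewrite expr2 mulrA ler_wpM2l//; last by rewrite /D; lra.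
    by rewrite mulr_ge0 ?(ltW e4)// /D; lra.
  have Ee : e * D ^+ 2 = e / 4 * D ^+ 2 * 4 by field.
  rewrite Ee; move: (e / 4 * D ^+ 2) Dx Dy => q Dx Dy.
  move: W1 W2 U1 U2; rewrite !ler_norml /mu; lra.
(* The horizontal sides y = 0 and y = T cancel by periodicity. *)
have Wper : W T s1 - W T s0 = W 0 s1 - W 0 s0.
  apply/eqP; rewrite -subr_eq0 -normr_le0.
  suff : `|W T s1 - W T s0 - (W 0 s1 - W 0 s0)| <= 0 * (s1 - s0).
    by rewrite mul0r.
  apply: (@increment_le _ (W T) (v^~ T) (W 0) (v^~ 0)) => // x xs.
  - by apply: HW; lra.
  - by apply: HW; lra.
  - by rewrite -[T]add0r per subrr normr0.
have U1 : U s1 T - U s1 0 <= B * T.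
  have [c cab ->] : exists2 c, c \in `[0, T] &
    U s1 T - U s1 0 = u s1 c * (T - 0).
    apply: MVT_segment; first exact: ltW.
      by move=> x; rewrite in_itv/= => xT; apply: HU; lra.
    apply: derivable_within_continuous => x; rewrite in_itv/= => xT.
    by apply: (@ex_derive _ _ _ _ _ _ _ (HU s1 x _ _)); lra.
  by rewrite subr0 ler_wpM2r// ltW.
have U0 : A * T <= U s0 T - U s0 0.
  have [c cab ->] : exists2 c, c \in `[0, T] &
    U s0 T - U s0 0 = u s0 c * (T - 0).
    apply: MVT_segment; first exact: ltW.
      by move=> x; rewrite in_itv/= => xT; apply: HU; lra.
    apply: derivable_within_continuous => x; rewrite in_itv/= => xT.
    by apply: (@ex_derive _ _ _ _ _ _ _ (HU s0 x _ _)); lra.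
  by rewrite subr0 ler_wpM2r// ltW.
rewrite -(ler_pM2r T0); move: mu0; rewrite /mu; lra.
Qed.
End Conservation.

(** * Cauchy's estimate in one variable *)
Import ComplexField.Normc.

Section Normc.
Variable R : realType.
Implicit Types z w : R[i].

Lemma normc_ge0 z : 0 <= normc z.
Proof. by case: z => a b; rewrite /normc sqrtr_ge0. Qed.

Lemma normcD z w : normc (z + w) <= normc z + normc w.
Proof. exact: le_normcD. Qed.

Lemma normcN z : normc (- z) = normc z.
Proof. exact: complex.normcN. Qed.

Lemma normcB z w : normc (z - w) <= normc z + normc w.
Proof. by rewrite -(normcN w); exact: normcD. Qed.

Lemma normc_real (x : R) : normc x%:C = `|x|.
Proof. by rewrite /normc/= expr0n/= addr0 sqrtr_sqr. Qed.

Lemma Re_le_normc z : `|complex.Re z| <= normc z.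
Proof.
case: z => a b; rewrite /normc/= -sqrtr_sqr.
by apply: ler_wsqrtr; rewrite lerDl sqr_ge0.
Qed.

Lemma Im_le_normc z : `|complex.Im z| <= normc z.
Proof.
case: z => a b; rewrite /normc/= -[leLHS]sqrtr_sqr.
by apply: ler_wsqrtr; rewrite lerDr sqr_ge0.
Qed.

Lemma normc_le_ReIm z : normc z <= `|complex.Re z| + `|complex.Im z|.
Proof.
case: z => a b; rewrite /normc/= -(@ger0_norm _ (`|a| + `|b|)) ?addr_ge0//.
rewrite -[leRHS]sqrtr_sqr; apply: ler_wsqrtr; rewrite sqrrD !real_normK ?num_real//.
by rewrite -addrA lerD2l lerDr mulrn_wge0// mulr_ge0.
Qed.

Lemma normc_eq0 z : (normc z == 0) = (z == 0).
Proof.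
apply/eqP/eqP => [|->]; [exact: eq0_normc|exact: normc0].
Qed.

Lemma normc_gt0 z : (0 < normc z) = (z != 0).
Proof. by rewrite lt_def normc_ge0 andbT normc_eq0. Qed.

Lemma norm_normc z : `|z| = (normc z)%:C.
Proof. by []. Qed.
End Normc.

Section RealDerivative.
Variable R : realType.

Lemma is_derive_eps (f : R -> R) (x d : R) : is_derive x 1 f d ->
  forall e : R, 0 < e -> exists2 dl : R, 0 < dl &
    forall h, `|h| < dl -> `|f (x + h) - f x - d * h| <= e * `|h|.
Proof.
move=> [dx Dx] e e0.
have : (fun h : R => h^-1 *: ((f \o shift x) (h *: 1) - f x)) @ 0^' --> d.
  by rewrite -Dx; exact: dx.
move=> /cvgrPdist_le/(_ _ e0); rewrite near_withinE => /nbhs_ballP[dl /= dl0 H].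
exists dl => // h hd; have [->|h0] := eqVneq h 0.
  by rewrite addr0 subrr mulr0 subrr normr0 mulr0.
have := H h; rewrite /ball/= sub0r normrN => /(_ hd h0).
rewrite /GRing.scale/= mulr1 (addrC h x) distrC => K.
rewrite (_ : _ - d * h = (h^-1 * (f (x + h) - f x) - d) * h); last by field.
by rewrite normrM ler_wpM2r.
Qed.

Lemma eps_is_derive (f : R -> R) (x d : R) :
  (forall e : R, 0 < e -> exists2 dl : R, 0 < dl &
    forall h, `|h| < dl -> `|f (x + h) - f x - d * h| <= e * `|h|) ->
  is_derive x 1 f d.
Proof.
move=> H.
have C : (fun h : R => h^-1 *: ((f \o shift x) (h *: 1) - f x)) @ 0^' --> d.
  apply/cvgrPdist_le => e e0; have [dl dl0 Hd] := H e e0.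
  rewrite near_withinE; apply/nbhs_ballP; exists dl => //= h.
  rewrite /ball/= sub0r normrN => hd h0.
  rewrite /GRing.scale/= mulr1 (addrC h) distrC.
  rewrite (_ : _ - d = (f (x + h) - f x - d * h) / h); last by field.
  by rewrite normrM normfV ler_pdivrMr ?normr_gt0// Hd.
by apply: DeriveDef; [apply/cvg_ex; exists d|exact/cvg_lim].
Qed.
End RealDerivative.

Section ComplexDerivative.
Variable R : realType.
Local Notation C := R[i].
Implicit Types (f g : C -> C) (z c d : C).

(** [c] is the complex derivative of [f] at [z].  The real modulus [normc] is
    used instead of the norm of R[i], whose values are complex, so that
    inequalities live in the ordered field R. *)
Definition cderiv f z c := forall e : R, 0 < e ->
  exists2 dl : R, 0 < dl & forall h, normc h < dl ->
    normc (f (z + h) - f z - c * h) <= e * normc h.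

Lemma cderiv_cst z c : cderiv (fun=> c) z 0.
Proof.
move=> e e0; exists 1 => // h _.
by rewrite subrr mul0r subrr normc0 mulr_ge0 ?normc_ge0// ltW.
Qed.

Lemma cderivD f g z c d : cderiv f z c -> cderiv g z d ->
  cderiv (fun x => f x + g x) z (c + d).
Proof.
move=> Hf Hg e e0; have e2 : 0 < e / 2 by rewrite divr_gt0.
have [d1 d10 H1] := Hf _ e2; have [d2 d20 H2] := Hg _ e2.
exists (Num.min d1 d2); first by rewrite lt_min d10.
move=> h; rewrite lt_min => /andP[/H1 h1 /H2 h2].
rewrite (_ : _ - _ = (f (z + h) - f z - c * h) + (g (z + h) - g z - d * h));
  last by ring.
by apply: le_trans (normcD _ _) _; lra.
Qed.

Lemma cderiv_lip f z c : cderiv f z c -> exists2 dl : R, 0 < dl &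
  forall h, normc h < dl -> normc (f (z + h) - f z) <= (normc c + 1) * normc h.
Proof.
move=> Hf; have [dl dl0 H] := Hf _ ltr01; exists dl => // h /H.
rewrite mul1r => K; rewrite -(subrK (c * h) (f (z + h) - f z)).
apply: le_trans (normcD _ _) _; rewrite normcM; lra.
Qed.

Lemma cderivM f g z c d : cderiv f z c -> cderiv g z d ->
  cderiv (fun x => f x * g x) z (c * g z + f z * d).
Proof.
move=> Hf Hg e e0.
set K := (normc c + 1) * (normc d + 1).
have K0 : 0 < K by rewrite mulr_gt0// ltr_wpDl// normc_ge0.
pose e1 := e / 3 / (normc (g z) + 1); pose e2 := e / 3 / (normc (f z) + 1).
have e10 : 0 < e1 by rewrite !divr_gt0// ltr_wpDl// normc_ge0.
have e20 : 0 < e2 by rewrite !divr_gt0// ltr_wpDl// normc_ge0.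
have [d1 d10 H1] := Hf _ e10; have [d2 d20 H2] := Hg _ e20.
have [d3 d30 H3] := cderiv_lip Hf; have [d4 d40 H4] := cderiv_lip Hg.
exists (Num.min (Num.min d1 d2) (Num.min (Num.min d3 d4) (e / 3 / K))).
  by rewrite !lt_min d10 d20 d30 d40 !divr_gt0.
move=> h; rewrite !lt_min => /andP[/andP[/H1 h1 /H2 h2]].
move=> /andP[/andP[/H3 h3 /H4 h4] h5].
set F := f (z + h) in h1 h3 *; set G := g (z + h) in h2 h4 *.
rewrite (_ : _ - _ = (F - f z - c * h) * g z + f z * (G - g z - d * h)
  + (F - f z) * (G - g z)); last by ring.
have n0 (x : C) : 0 <= normc x by exact: normc_ge0.
apply: le_trans (normcD _ _) _; rewrite normcM.
apply: le_trans (lerD (normcD _ _) (ler_pM (n0 _) (n0 _) h3 h4)) _.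
rewrite !normcM mulrACA -/K -expr2.
move: h5; rewrite ltr_pdivlMr// => h5.
have A1 : normc (F - f z - c * h) * normc (g z) <= e / 3 * normc h.
  apply: le_trans (ler_wpM2r (n0 _) h1) _.
  rewrite mulrAC ler_wpM2r// /e1 mulrAC ler_pdivrMr ?ltr_wpDl//.
  by rewrite ler_wpM2l ?lerDl// divr_ge0// ltW.
have A2 : normc (f z) * normc (G - g z - d * h) <= e / 3 * normc h.
  apply: le_trans (ler_wpM2l (n0 _) h2) _.
  rewrite mulrA ler_wpM2r// /e2 mulrA ler_pdivrMr ?ltr_wpDl//.
  by rewrite mulrC ler_wpM2l ?lerDl// divr_ge0// ltW.
have A3 : K * normc h ^+ 2 <= e / 3 * normc h.
  by rewrite expr2 mulrA ler_wpM2r// mulrC ltW.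
lra.
Qed.

Lemma cderiv_comp f g z c d : cderiv f z c -> cderiv g (f z) d ->
  cderiv (fun x => g (f x)) z (d * c).
Proof.
move=> Hf Hg e e0; have n0 (x : C) : 0 <= normc x by exact: normc_ge0.
pose e1 := e / 2 / (normc c + 1); pose e2 := e / 2 / (normc d + 1).
have e10 : 0 < e1 by rewrite !divr_gt0// ltr_wpDl.
have e20 : 0 < e2 by rewrite !divr_gt0// ltr_wpDl.
have [d1 d10 H1] := Hg _ e10; have [d2 d20 H2] := Hf _ e20.
have [d3 d30 H3] := cderiv_lip Hf.
exists (Num.min (Num.min d2 d3) (d1 / (normc c + 1))).
  by rewrite !lt_min d20 d30 divr_gt0// ltr_wpDl.
move=> h; rewrite !lt_min => /andP[/andP[/H2 h2 /H3 h3]].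
rewrite ltr_pdivlMr ?ltr_wpDl// mulrC => h4.
have := H1 _ (le_lt_trans h3 h4); rewrite subrKC => h5.
set F := f (z + h) in h2 h3 h5 *.
rewrite (_ : _ - _ = (g F - g (f z) - d * (F - f z)) + d * (F - f z - c * h));
  last by ring.
apply: le_trans (normcD _ _) _; rewrite normcM.
have A1 : normc (g F - g (f z) - d * (F - f z)) <= e / 2 * normc h.
  apply: le_trans h5 _; apply: le_trans (ler_wpM2l (ltW e10) h3) _.
  by rewrite mulrA divfK// gt_eqF// ltr_wpDl.
have A2 : normc d * normc (F - f z - c * h) <= e / 2 * normc h.
  apply: le_trans (ler_wpM2l (n0 _) h2) _.
  rewrite mulrA ler_wpM2r// /e2 mulrA ler_pdivrMr ?ltr_wpDl//.
  by rewrite mulrC ler_wpM2l ?lerDl// divr_ge0// ltW.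
lra.
Qed.

Lemma cderiv_affine a b z : cderiv (fun x => a + b * x) z b.
Proof.
move=> e e0; exists 1 => // h _.
rewrite (_ : _ - _ = 0); last by ring.
by rewrite normc0 mulr_ge0 ?normc_ge0// ltW.
Qed.

Lemma expcD z w : expc (z + w) = expc z * expc w.
Proof.
case: z w => a b [c d]; rewrite /expc /= expRD cosD sinD; simpc.
by congr (_ +i* _); ring.
Qed.

Lemma expc0 : expc (0 : C) = 1.
Proof. by rewrite /expc/= expR0 cos0 sin0 mulr1 mulr0. Qed.

Lemma expc_neq0 z : expc z != 0.
Proof.
apply/eqP => E; have := expcD z (- z); rewrite subrr expc0 E mul0r.
by move/eqP; rewrite oner_eq0.
Qed.

Lemma normc_expc z : normc (expc z) = expR (complex.Re z).
Proof.
case: z => a b; rewrite /expc/normc/= !exprMn -mulrDr cos2Dsin2 mulr1.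
by rewrite sqrtr_sqr ger0_norm// expR_ge0.
Qed.

(** Re (e^h - 1 - h) = (e^a - 1 - a) cos b + (1 + a) (cos b - 1) and
    Im (e^h - 1 - h) = (e^a - 1) sin b + (sin b - b) for h = a + ib, which
    reduces the claim to the real derivatives of exp, cos and sin at 0. *)
Lemma expc_cderiv0 : cderiv (@expc R) 0 1.
Proof.
move=> e e0; have n0 (x : C) : 0 <= normc x by exact: normc_ge0.
have [e1 [e10 ee e1l]] : exists e1, [/\ 0 < e1, e1 <= e / 8 & e1 <= 1].
  exists (Num.min (e / 8) 1); rewrite lt_min ltr01 divr_gt0//.
  by rewrite !ge_min !lexx orbT.
have [d1 d10 H1] := is_derive_eps (is_derive_expR (0 : R)) e10.
have [d2 d20 H2] := is_derive_eps (is_derive_cos (0 : R)) e10.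
have [d3 d30 H3] := is_derive_eps (is_derive_sin (0 : R)) e10.
exists (Num.min (Num.min d1 d2) (Num.min d3 e1)).
  by rewrite !lt_min d10 d20 d30 e10.
case=> a b; rewrite !lt_min => /andP[/andP[m1 m2] /andP[m3 m4]].
have an : `|a| <= normc (a +i* b) := Re_le_normc (a +i* b).
have bn : `|b| <= normc (a +i* b) := Im_le_normc (a +i* b).
have := H1 a (le_lt_trans an m1); have := H2 b (le_lt_trans bn m2).
have := H3 b (le_lt_trans bn m3); rewrite !add0r expR0 cos0 sin0 expc0.
rewrite mul1r oppr0 mul0r !subr0 mul1r addr0 => h3 h2 h1.
rewrite mul1r; apply: le_trans (normc_le_ReIm _) _.
move: m4; set N := normc (a +i* b) in an bn m1 m2 m3 * => m4.
rewrite /= oppr0 addr0.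
have sb : `|sin b| <= 2 * e1.
  have := ler_normD (sin b - b) b; rewrite subrK.
  by have := ler_wpM2r (normr_ge0 b) e1l; lra.
have ea : `|expR a - 1| <= 2 * `|a|.
  have := ler_normD (expR a - 1 - a) a; rewrite subrK.
  by have := ler_wpM2r (normr_ge0 a) e1l; lra.
have A : `|expR a * cos b - 1 - a| <= e1 * `|a| + 2 * (e1 * `|b|).
  rewrite (_ : _ - a = (expR a - 1 - a) * cos b + (1 + a) * (cos b - 1));
    last by ring.
  apply: le_trans (ler_normD _ _) _; rewrite !normrM; apply: lerD.
    rewrite -[leRHS]mulr1; apply: ler_pM => //.
    by rewrite ler_norml cos_geN1 cos_le1.
  apply: ler_pM => //; have := ler_normD 1 a; rewrite normr1; lra.
have B : `|expR a * sin b - b| <= 2 * `|a| * (2 * e1) + e1 * `|b|.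
  rewrite (_ : _ - b = (expR a - 1) * sin b + (sin b - b)); last by ring.
  apply: le_trans (ler_normD _ _) _; rewrite !normrM; apply: lerD => //.
  exact: ler_pM.
have C1 : e1 * `|a| <= e / 8 * N by apply: ler_pM => //; exact: ltW.
have C2 : e1 * `|b| <= e / 8 * N by apply: ler_pM => //; exact: ltW.
by lra.
Qed.

Lemma expc_cderiv z : cderiv (@expc R) z (expc z).
Proof.
move=> e e0; have Ep : 0 < normc (expc z) by rewrite normc_gt0 expc_neq0.
have e1 : 0 < e / normc (expc z) by rewrite divr_gt0.
have [dl dl0 H] := expc_cderiv0 e1; exists dl => // h /H.
rewrite add0r expc0 mul1r => K.
rewrite expcD (_ : _ - _ = expc z * (expc h - 1 - h)); last by ring.
by rewrite normcM mulrC -ler_pdivlMr// mulrAC.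
Qed.

Lemma expc2pi z : expc (z + 0 +i* (pi *+ 2)) = expc z.
Proof.
by case: z => a b; rewrite /expc/= addr0 sinD2pi cosD2pi.
Qed.

Lemma cderiv_expcN z : cderiv (fun w => expc (- w)) z (- expc (- z)).
Proof.
have := cderiv_comp (cderiv_affine 0 (-1) z) (@expc_cderiv (0 + -1 * z)).
rewrite add0r mulrN1 mulN1r.
rewrite (_ : (fun x : C => _) = (fun w : C => expc (- w)))//.
by apply/funext => x; rewrite add0r mulN1r.
Qed.

(** The mean of F(s + it) = (f(a + e^(s + it)) - f(a)) e^(-(s + it)) over a
    period in t is the same for s near -oo, where F is close to c, and for
    s = ln r, where |F| <= 2 M / r. *)
Lemma Re_cauchy_estimate f a c (r M : R) : 0 < r ->
  (forall z, exists d, cderiv f z d) -> cderiv f a c ->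
  (forall h, normc h <= r -> normc (f (a + h)) <= M) ->
  complex.Re c <= 2 * M / r.
Proof.
move=> r0 Hf Hc HM.
pose F w := (f (a + expc w) - f a) * expc (- w).
have HF w : exists d, cderiv F w d.
  have [d Hd] := Hf (a + 1 * expc w).
  have K := cderiv_comp (cderiv_comp (expc_cderiv w) (cderiv_affine a 1 (expc w))) Hd.
  have := cderivM (cderivD K (cderiv_cst w (- f a))) (cderiv_expcN w).
  set D := (X in cderiv _ _ X); exists D.
  rewrite (_ : F = (fun x => (f (a + 1 * expc x) - f a) * expc (- x)))//.
  by apply/funext => x; rewrite mul1r.
have perF w : F (w + 0 +i* (pi *+ 2)) = F w.
  rewrite /F expc2pi; congr (_ * _); rewrite -[LHS]expc2pi; congr expc.
  by rewrite opprD subrK.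
have bndF s t : normc (F (s +i* t)) <= 2 * M / expR s \/ r < expR s.
  have [rs|sr] := ltP r (expR s); [by right|left].
  rewrite /F normcM normc_expc.
  rewrite (_ : complex.Re (- _) = - s)// expRN ler_wpM2r ?invr_ge0 ?expR_ge0//.
  apply: le_trans (normcB _ _) _; rewrite mulr2n mulrDl mul1r; apply: lerD.
    by apply: HM; rewrite normc_expc.
  by have := HM 0; rewrite normc0 addr0; apply; exact: ltW.
apply/ler_addgt0Pr => eta eta0.
have [dl dl0 Hdl] := Hc _ eta0.
(* On the circle of radius q the quotient is within [eta] of c. *)
pose q := Num.min (dl / 2) r.
have q0 : 0 < q by rewrite lt_min r0 divr_gt0.
have qd : q < dl.
  apply: (@le_lt_trans _ _ (dl / 2)); first by rewrite ge_min lexx.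
  by rewrite ltr_pdivrMr//; lra.
have qr : q <= r by rewrite ge_min lexx orbT.
suff: complex.Re c - eta <= 2 * M / r by lra.
apply: (@periodic_mean_le R (fun s t => complex.Re (F (s +i* t)))
   (fun s t => complex.Im (F (s +i* t))) _ (pi *+ 2) _ _ (ln q) (ln r)).
(* The Cauchy-Riemann equations of F, with derivative d, are the
   conservation law for (Re F, Im F). *)
- move=> x y; have [d Hd] := HF (x +i* y).
  exists (complex.Re d), (- complex.Im d), (complex.Im d) => e e0.
  have [dl' dl'0 H'] := Hd _ e0.
  exists (dl' / 2); first by rewrite divr_gt0.
  move=> h k hd kd.
  have nhk : normc (h +i* k) <= `|h| + `|k| by exact: normc_le_ReIm.
  have := H' (h +i* k); rewrite (le_lt_trans nhk) => [/(_ isT)|]; last lra.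
  rewrite -[(x +i* y) + (h +i* k)]/((x + h) +i* (y + k)) => K.
  have {}K := le_trans K (ler_wpM2l (ltW e0) nhk).
  move: (le_trans (Re_le_normc _) K) (le_trans (Im_le_normc _) K).
  case: (F (_ +i* _)) => f1 f2; case: (F (_ +i* _)) => f3 f4.
  case: d {Hd H' K} => d1 d2 /=; split.
    by rewrite (_ : _ - _ - _ = f1 - f3 - (d1 * h - d2 * k)) //; ring.
  by rewrite (_ : _ - _ - _ = f2 - f4 - (d1 * k + d2 * h)) //; ring.
- by rewrite mulrn_wgt0// pi_gt0.
- move=> x y; rewrite -(perF (x +i* y)); congr (complex.Im (F _)).
  by simpc.
- by rewrite ler_ln.
- move=> t; set w := ln q +i* t.
  have ew : normc (expc w) = q by rewrite normc_expc/= lnK.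
  have := Hdl (expc w); rewrite ew => /(_ qd) K.
  have : normc (F w - c) <= eta.
    have -> : F w - c = (f (a + expc w) - f a - c * expc w) * expc (- w).
      have ee : expc w * expc (- w) = 1 by rewrite -expcD subrr expc0.
      by rewrite /F [RHS]mulrBl -[c * _ * _]mulrA ee mulr1.
    rewrite normcM normc_expc (_ : complex.Re (- w) = - ln q)// expRN lnK//.
    by rewrite ler_pdivrMr.
  move=> /(le_trans (Re_le_normc _)); rewrite ler_norml.
  by case: (F w) => f1 f2; case: c {Hc Hdl K} => c1 c2 /=; lra.
move=> t; apply: le_trans (ler_norm _) _; apply: le_trans (Re_le_normc _) _.
by have [|] := bndF (ln r) t; rewrite lnK// ltxx.
Qed.

(** Rotating f by the unit number conj(c) / |c| makes c real and positive. *)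
Lemma cauchy_estimate f a c (r M : R) : 0 < r ->
  (forall z, exists d, cderiv f z d) -> cderiv f a c ->
  (forall h, normc h <= r -> normc (f (a + h)) <= M) ->
  normc c <= 2 * M / r.
Proof.
move=> r0 Hf Hc HM.
have [->|c0] := eqVneq c 0.
  rewrite normc0 divr_ge0 ?(ltW r0)// mulr_ge0//.
  by have := HM 0; rewrite normc0 => /(_ (ltW r0)); apply: le_trans; exact: normc_ge0.
pose l : C := conjc c / (normc c)%:C.
have n0 : normc c != 0 by rewrite normc_eq0.
have lc : l * c = (normc c)%:C.
  have E : c * conjc c = (normc c)%:C * (normc c)%:C.
    by rewrite -expr2 -norm_normc sqr_normc.
  rewrite /l mulrAC (mulrC _ c) E mulfK// -[0]/((0 : R)%:C).
  by apply/eqP => -[]; apply/eqP.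
have nl : normc l = 1.
  have := congr1 (@normc R) lc; rewrite normcM normc_real ger0_norm ?normc_ge0//.
  by move/(canRL (mulfK n0)); rewrite divff.
have lZ z d : cderiv f z d -> cderiv (fun x => l * f x) z (l * d).
  move=> Hd; have := cderivM (cderiv_cst z l) Hd.
  by rewrite mul0r add0r.
have := @Re_cauchy_estimate (fun x => l * f x) a (l * c) r M r0.
rewrite lc /=; apply.
- by move=> z; have [d Hd] := Hf z; exists (l * d); exact: lZ.
- by rewrite -lc; exact: lZ.
- by move=> h hr; rewrite normcM nl mul1r HM.
Qed.
End ComplexDerivative.

(** * Complex differentials on C^n *)

(** The norm of C^n takes its values in R[i]; [rnorm] is the same number as an
    element of R. *)
Definition rnorm {R : realType} {n : nat} (v : 'rV[R[i]]_n) : R := complex.Re `|v|.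

Section VectorNorm.
Variables (R : realType) (n : nat).
Local Notation C := R[i].
Local Notation V := 'rV[R[i]]_n.
Implicit Types (v w z h : V).

Lemma rnormE v : `|v| = (rnorm v)%:C.
Proof.
have := normr_ge0 v; rewrite /rnorm lecE /= => /andP[/eqP + _].
by case: (`|v|) => a b /= ->; rewrite complexr0.
Qed.

Lemma rnorm_ge0 v : 0 <= rnorm v.
Proof. by rewrite -lecR -rnormE; exact: normr_ge0. Qed.

Lemma rnormD v w : rnorm (v + w) <= rnorm v + rnorm w.
Proof. by rewrite -lecR rmorphD/= -!rnormE ler_normD. Qed.

Lemma rnormZ (a : C) v : rnorm (a *: v) = normc a * rnorm v.
Proof.
apply: complexI; rewrite -rnormE normrZ rmorphM/= -rnormE.
by [].
Qed.

Lemma rnorm0 : rnorm (0 : V) = 0.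
Proof. by rewrite /rnorm normr0. Qed.

Lemma rnorm_eq0 v : rnorm v = 0 -> v = 0.
Proof. by move=> v0; apply/normr0_eq0; rewrite rnormE v0. Qed.

Lemma rnorm_coord v j : normc (v 0 j) <= rnorm v.
Proof.
rewrite -lecR -rnormE -norm_normc [leRHS]/Num.norm/= mx_normE.
have K : `|v 0 j|%:nng <=
    \big[Num.max/0%:nng]_(i : 'I_1 * 'I_n) `|v i.1 i.2|%:nng.
  by apply/bigmax_geP; right; exists (ord0, j).
by rewrite -num_le in K.
Qed.

Lemma rnorm_delta j : rnorm (delta_mx 0 j : V) <= 1.
Proof.
have [->|v0] := eqVneq (delta_mx 0 j : V) 0; first by rewrite rnorm0.
have /mx_norm_neq0[[i k] E] : mx_norm (delta_mx 0 j : V) != 0.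
  by apply: contra_neq v0; exact: mx_norm_eq0.
rewrite -lecR -rnormE /Num.norm/= E mxE.
by case: (_ && _); rewrite ?normr1 ?normr0// ler01.
Qed.

Lemma rnorm_sum (I : Type) (s : seq I) (F : I -> V) :
  rnorm (\sum_(i <- s) F i) <= \sum_(i <- s) rnorm (F i).
Proof.
elim/big_ind2 : _ => //; first by rewrite rnorm0.
by move=> v a w b va wb; apply: le_trans (rnormD _ _) _; exact: lerD.
Qed.

Lemma normc_sum (I : Type) (s : seq I) (F : I -> C) :
  normc (\sum_(i <- s) F i) <= \sum_(i <- s) normc (F i).
Proof.
elim/big_ind2 : _ => //; first by rewrite normc0.
by move=> v a w b va wb; apply: le_trans (normcD _ _) _; exact: lerD.
Qed.

Lemma nbhs_rnormP z (P : set V) :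
  nbhs z P <-> exists2 dl : R, 0 < dl & forall h, rnorm h < dl -> P (z + h).
Proof.
split=> [/nbhs_normP[e /= e0 H]|[dl dl0 H]].
  move: e0; case: e H => a b H; rewrite ltcE/= => /andP[/eqP b0 a0].
  exists a => // h ha; apply: H; rewrite /= opprD addNKr normrN rnormE.
  by rewrite b0 complexr0 ltcR.
apply: (iffRL (nbhs_normP z P)); exists dl%:C; first by rewrite /= ltcR.
move=> w /=; rewrite distrC rnormE ltcR => /H; by rewrite subrKC.
Qed.

Lemma continuousP_rnorm (g : V -> C) : continuous g <->
  forall z (e : R), 0 < e -> exists2 dl : R, 0 < dl &
    forall h, rnorm h < dl -> normc (g (z + h) - g z) <= e.
Proof.
split=> [cg z e e0|H z].
  have /cvgrPdist_le/(_ e%:C) := cg z; rewrite ltcR => /(_ e0)/nbhs_rnormP[dl dl0 H].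
  exists dl => // h /H; by rewrite distrC norm_normc lecR.
apply/(cvgrPdist_le (F := nbhs z)) => -[a b]; rewrite ltcE/= => /andP[/eqP -> a0].
have [dl dl0 Hd] := H z a a0.
apply/nbhs_rnormP; exists dl => // h /Hd.
by rewrite distrC norm_normc complexr0 lecR.
Qed.

Definition lform (c : 'I_n -> C) h : C := \sum_(j < n) c j * h 0 j.

Lemma lform_linear c : linear (lform c).
Proof.
move=> a u v; rewrite /lform scaler_sumr -big_split/=; apply: eq_bigr => j _.
by rewrite !mxE /GRing.scale/=; ring.
Qed.

HB.instance Definition _ c := GRing.isLinear.Build C V C _ (lform c) (@lform_linear c).

Lemma lform_delta c j : lform c (delta_mx 0 j) = c j.
Proof.
rewrite /lform (bigD1 j)//= big1 => [|i ij]; rewrite !mxE ?eqxx ?mulr1 ?addr0//.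
by rewrite (negbTE ij) mulr0.
Qed.

Lemma lform_le c h : normc (lform c h) <= (\sum_j normc (c j)) * rnorm h.
Proof.
rewrite mulr_suml; apply: le_trans (normc_sum _ _) _; apply: ler_sum => j _.
by rewrite normcM ler_wpM2l ?rnorm_coord// normc_ge0.
Qed.

Lemma lformB c d h : lform (fun j => c j - d j) h = lform c h - lform d h.
Proof. by rewrite /lform -sumrB; apply: eq_bigr => j _; rewrite mulrBl. Qed.

Lemma lform_continuous c : continuous (lform c).
Proof.
apply/continuousP_rnorm => z e e0; set S := \sum_j normc (c j).
have S0 : 0 <= S by apply: sumr_ge0 => j _; exact: normc_ge0.
exists (e / (S + 1)); first by rewrite divr_gt0// ltr_wpDl.
move=> h; rewrite ltr_pdivlMr ?ltr_wpDl// => hd.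
rewrite linearD/= addrC addKr; apply: le_trans (lform_le _ _) _; rewrite -/S.
by have := rnorm_ge0 h; lra.
Qed.

(** [c] is the vector of complex partial derivatives of [g] at [z], where [g]
    is complex differentiable. *)
Definition cgrad (g : V -> C) z c := forall e : R, 0 < e ->
  exists2 dl : R, 0 < dl & forall h, rnorm h < dl ->
    normc (g (z + h) - g z - lform c h) <= e * rnorm h.

Lemma differentiableP_cgrad (g : V -> C) z :
  differentiable g z <-> exists c, cgrad g z c.
Proof.
split=> [dg|[c Hc]].
  exists (fun j => 'd g z (delta_mx 0 j)) => e e0.
  have := diff_locally dg => /eqaddoP/(_ e%:C); rewrite ltcR => /(_ e0).
  move=> /nbhs_rnormP[dl dl0 H]; exists dl => // h /H.
  rewrite add0r rnormE norm_normc -rmorphM lecR.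
  rewrite !fctE/= opprD addrA (addrC h); congr (normc (_ - _) <= _).
  rewrite {1}[h]row_sum_delta linear_sum; apply: eq_bigr => j _.
  by rewrite linearZ/= /GRing.scale/= mulrC.
have E : g \o shift z = cst (g z) + lform c +o_ (0 : V) id.
  apply/eqaddoP => -[a b]; rewrite ltcE/= => /andP[/eqP -> a0].
  have [dl dl0 H] := Hc a a0.
  apply/nbhs_rnormP; exists dl => // h /H.
  rewrite add0r rnormE norm_normc complexr0 -rmorphM lecR.
  by rewrite !fctE/= opprD addrA (addrC h).
have D := diff_unique (@lform_continuous c) E.
by apply/diff_locallyP; rewrite D; split => //; exact: lform_continuous.
Qed.
End VectorNorm.

(** * Entire functions on C^n are smooth *)
Section Holomorphic.
Variables (R : realType) (n : nat).
Local Notation C := R[i].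
Local Notation V := 'rV[R[i]]_n.
Implicit Types (v w z h : V) (g : V -> C).

Definition entire g := forall z, exists c, cgrad g z c.

Definition ball_bounded g z (r M : R) := forall h, rnorm h <= r -> normc (g (z + h)) <= M.

Lemma cgrad_line g z h (t : C) c : cgrad g (z + t *: h) c ->
  cderiv (fun s => g (z + s *: h)) t (lform c h).
Proof.
move=> Hg e e0; have h1 : 0 < rnorm h + 1 by rewrite ltr_wpDl// rnorm_ge0.
have e1 : 0 < e / (rnorm h + 1) by rewrite divr_gt0.
have [dl dl0 H] := Hg _ e1; exists (dl / (rnorm h + 1)); first by rewrite divr_gt0.
move=> s; rewrite ltr_pdivlMr// => sd; have s0 := normc_ge0 s.
have := H (s *: h); rewrite rnormZ (le_lt_trans _ sd) => [/(_ isT)|]; last first.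
  by rewrite ler_wpM2l// lerDl.
rewrite (_ : lform c (s *: h) = lform c h * s); last first.
  by rewrite linearZ/= mulrC.
move=> K; rewrite /= scalerDl addrA; apply: le_trans K _.
rewrite mulrCA [leRHS]mulrC ler_wpM2l// mulrAC ler_pdivrMr//.
by rewrite ler_wpM2l ?lerDl// ltW.
Qed.

Lemma cgrad_comb g g' z c c' (a : C) : cgrad g z c -> cgrad g' z c' ->
  cgrad (fun x => a * g x + g' x) z (fun j => a * c j + c' j).
Proof.
move=> Hg Hg' e e0; have n0 := normc_ge0 a.
have e1 : 0 < e / 2 / (normc a + 1) by rewrite !divr_gt0// ltr_wpDl.
have e2 : 0 < e / 2 by rewrite divr_gt0.
have [d1 d10 H1] := Hg _ e1; have [d2 d20 H2] := Hg' _ e2.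
exists (Num.min d1 d2); first by rewrite lt_min d10.
move=> h; rewrite lt_min => /andP[/H1 h1 /H2 h2].
have -> : lform (fun j => a * c j + c' j) h = a * lform c h + lform c' h.
  by rewrite /lform mulr_sumr -big_split/=; apply: eq_bigr => j _; ring.
rewrite (_ : _ - _ = a * (g (z + h) - g z - lform c h)
   + (g' (z + h) - g' z - lform c' h)); last by ring.
apply: le_trans (normcD _ _) _; rewrite normcM.
have : normc a * normc (g (z + h) - g z - lform c h) <= e / 2 * rnorm h.
  apply: le_trans (ler_wpM2l n0 h1) _.
  rewrite mulrA ler_wpM2r ?rnorm_ge0// mulrA ler_pdivrMr ?ltr_wpDl//.
  by rewrite mulrC ler_wpM2l ?lerDl// ltW.
by lra.
Qed.

Lemma cgrad_0 z : cgrad (fun=> 0) z (fun=> 0).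
Proof.
move=> e e0; exists 1 => // h _; rewrite subrr sub0r normcN.
have -> : lform (fun=> 0) h = 0 :> C by rewrite /lform big1// => j _; exact: mul0r.
by rewrite normc0 mulr_ge0 ?rnorm_ge0// ltW.
Qed.

Lemma cgrad_shift g z h c : cgrad g (z + h) c -> cgrad (fun x => g (x + h)) z c.
Proof.
move=> Hg e /Hg[dl dl0 H]; exists dl => // k /H.
by rewrite /= (addrAC z h k).
Qed.

Lemma entire_continuous g : entire g -> continuous g.
Proof.
move=> Hg; apply/continuousP_rnorm => z e e0; have [c Hc] := Hg z.
have [d1 d10 H1] := Hc _ ltr01.
set S := \sum_j normc (c j).
have S0 : 0 <= S by apply: sumr_ge0 => j _; exact: normc_ge0.
exists (Num.min d1 (e / (S + 1))).
  by rewrite lt_min d10 divr_gt0// ltr_wpDl.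
move=> h; rewrite lt_min ltr_pdivlMr ?ltr_wpDl// => /andP[/H1 h1 h2].
rewrite -(subrK (lform c h) (g (z + h) - g z)).
apply: le_trans (normcD _ _) _.
have := lform_le c h; rewrite -/S; lra.
Qed.

Lemma entire_locally_bounded g z : entire g ->
  exists r M : R, 0 < r /\ ball_bounded g z r M.
Proof.
move=> /entire_continuous/continuousP_rnorm/(_ z 1 ltr01)[dl dl0 H].
exists (dl / 2), (1 + normc (g z)); split; first by rewrite divr_gt0.
move=> h hd; rewrite -(subrK (g z) (g (z + h))).
apply: le_trans (normcD _ _) _; rewrite lerD2r H//.
by apply: le_lt_trans hd _; rewrite ltr_pdivrMr//; lra.
Qed.

Lemma ball_bounded_shift g z h (r s M : R) : ball_bounded g z r M -> rnorm h + s <= r ->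
  ball_bounded g (z + h) s M.
Proof.
move=> H hs k ks; rewrite -addrA; apply: H; apply: le_trans (rnormD _ _) _.
by apply: le_trans hs; rewrite lerD2l.
Qed.

(** Cauchy's estimate on the complex line z + C v, on which the ball of radius
    r is a disc of radius r / |v|. *)
Lemma cauchy_cgrad g z c (r M : R) v : entire g -> 0 < r -> cgrad g z c ->
  ball_bounded g z r M -> normc (lform c v) <= 2 * M / r * rnorm v.
Proof.
move=> Hg r0 Hc HM.
have [v0|v0] := eqVneq (rnorm v) 0.
  by rewrite (rnorm_eq0 v0) linear0 normc0 rnorm0 mulr0.
have {}v0 : 0 < rnorm v by rewrite lt_def v0 rnorm_ge0.
have -> : 2 * M / r * rnorm v = 2 * M / (r / rnorm v).
  by field; rewrite !gt_eqF.
apply: (@cauchy_estimate R (fun s => g (z + s *: v)) 0).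
- by rewrite divr_gt0.
- by move=> t; have [d Hd] := Hg (z + t *: v); exists (lform d v); exact: cgrad_line.
- by apply: cgrad_line; rewrite scale0r addr0.
- by move=> t; rewrite ler_pdivlMr// add0r -rnormZ => /HM.
Qed.

Lemma cderiv_Re (f : C -> C) (t : R) d : cderiv f t%:C d ->
  is_derive t 1 (fun s : R => complex.Re (f s%:C)) (complex.Re d).
Proof.
move=> Hf; apply: eps_is_derive => e e0.
have [dl dl0 H] := Hf e e0; exists dl => // k kd.
have := H k%:C; rewrite normc_real => /(_ kd).
move=> /(le_trans (Re_le_normc _)); rewrite -rmorphD/=.
by case: (f _) => a b; case: (f _) => a' b'; case: d {Hf H} => p q /=;
   rewrite mulr0 subr0.
Qed.

Lemma cderiv_Im (f : C -> C) (t : R) d : cderiv f t%:C d ->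
  is_derive t 1 (fun s : R => complex.Im (f s%:C)) (complex.Im d).
Proof.
move=> Hf; apply: eps_is_derive => e e0.
have [dl dl0 H] := Hf e e0; exists dl => // k kd.
have := H k%:C; rewrite normc_real => /(_ kd).
move=> /(le_trans (Im_le_normc _)); rewrite -rmorphD/=.
by case: (f _) => a b; case: (f _) => a' b'; case: d {Hf H} => p q /=;
   rewrite mulr0 add0r.
Qed.

(** Real and imaginary parts are estimated separately, whence the factor 2. *)
Lemma mean_value (f : C -> C) (d : R -> C) (K : R) :
  (forall t : R, 0 <= t <= 1 -> cderiv f t%:C (d t)) ->
  (forall t : R, 0 <= t <= 1 -> normc (d t) <= K) ->
  normc (f 1 - f 0) <= 2 * K.
Proof.
move=> Hf HK; apply: le_trans (normc_le_ReIm _) _.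
have dRe (t : R) (t01 : 0 <= t <= 1) := cderiv_Re (Hf t t01).
have dIm (t : R) (t01 : 0 <= t <= 1) := cderiv_Im (Hf t t01).
have c0 (t : R) : 0 <= t <= 1 -> is_derive t 1 (fun _ : R => 0 : R) 0.
  by move=> _; exact: is_derive_cst.
have bRe (t : R) : 0 <= t <= 1 -> `|complex.Re (d t) - 0| <= K.
  by move=> ht; rewrite subr0; apply: le_trans (Re_le_normc _) _; exact: HK.
have bIm (t : R) : 0 <= t <= 1 -> `|complex.Im (d t) - 0| <= K.
  by move=> ht; rewrite subr0; apply: le_trans (Im_le_normc _) _; exact: HK.
have := increment_le ler01 dRe c0 bRe; have := increment_le ler01 dIm c0 bIm.
rewrite !subr0 mulr1 mulr2n mulrDl mul1r => HI HR.
have -> : complex.Re (f 1 - f 0) = complex.Re (f 1) - complex.Re (f 0).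
  by case: (f 1) => ? ?; case: (f 0).
have -> : complex.Im (f 1 - f 0) = complex.Im (f 1) - complex.Im (f 0).
  by case: (f 1) => ? ?; case: (f 0).
exact: lerD.
Qed.

Lemma segment_le (t : R) h (r : R) : 0 <= t <= 1 -> rnorm h <= r ->
  rnorm (t%:C *: h) <= r.
Proof.
move=> /andP[t0 t1] hr; rewrite rnormZ normc_real ger0_norm//.
by apply: le_trans hr; rewrite ler_piMl// rnorm_ge0.
Qed.

Lemma entire_lipschitz g z (r M : R) h : entire g -> 0 < r ->
  ball_bounded g z (2 * r) M -> rnorm h <= r ->
  normc (g (z + h) - g z) <= 4 * M / r * rnorm h.
Proof.
move=> Hg r0 HM hr.
have [c Hc] := boolp.choice Hg.
have -> : 4 * M / r * rnorm h = 2 * (2 * M / r * rnorm h) by ring.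
have := @mean_value (fun s => g (z + s *: h))
   (fun t => lform (c (z + t%:C *: h)) h) (2 * M / r * rnorm h).
rewrite scale1r scale0r addr0; apply.
  by move=> t _; exact: cgrad_line.
move=> t t01; apply: cauchy_cgrad => //.
apply: ball_bounded_shift HM _; have := segment_le t01 hr; lra.
Qed.

Lemma entire_shiftB g h : entire g -> entire (fun x => g (x + h) - g x).
Proof.
move=> Hg z; have [c Hc] := Hg z; have [d Hd] := Hg (z + h).
exists (fun j => -1 * c j + d j).
have := cgrad_comb (-1) Hc (cgrad_shift Hd).
set G := (X in cgrad X); rewrite (_ : G = fun x => g (x + h) - g x)//.
by apply/funext => x; rewrite /G mulN1r addrC.
Qed.

(** The function g(. + h) - g is entire and bounded by a multiple of |h|, so
    Cauchy's estimate bounds its differential, which is the variation of the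
    differential of g. *)
Lemma cgrad_lipschitz g z (r M : R) h v c d : entire g -> 0 < r ->
  ball_bounded g z (3 * r) M -> rnorm h <= r -> cgrad g z c -> cgrad g (z + h) d ->
  normc (lform d v - lform c v) <= 8 * M / r ^+ 2 * rnorm h * rnorm v.
Proof.
move=> Hg r0 HM hr Hc Hd.
have := cgrad_comb (-1) Hc (cgrad_shift Hd).
have -> : (fun x => -1 * g x + g (x + h)) = (fun x => g (x + h) - g x).
  by apply/funext => x; rewrite mulN1r addrC.
have -> : (fun j => -1 * c j + d j) = (fun j => d j - c j).
  by apply/funext => x; rewrite mulN1r addrC.
move=> K; rewrite -lformB.
have -> : 8 * M / r ^+ 2 * rnorm h * rnorm v = 2 * (4 * M / r * rnorm h) / r * rnorm v.
  by field; rewrite gt_eqF.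
apply: (cauchy_cgrad _ (entire_shiftB h Hg) r0 K) => k kr.
rewrite addrAC -addrA (addrC h) addrA.
apply: entire_lipschitz => //.
by apply: ball_bounded_shift HM _; lra.
Qed.

(** Mean value inequality for g(z + t h) - t dg_z(h), whose derivative in t is
    controlled by the Lipschitz bound on the differential. *)
Lemma second_order g z (r M : R) h c : entire g -> 0 < r ->
  ball_bounded g z (3 * r) M -> rnorm h <= r -> cgrad g z c ->
  normc (g (z + h) - g z - lform c h) <= 16 * M / r ^+ 2 * rnorm h ^+ 2.
Proof.
move=> Hg r0 HM hr Hc.
have [d Hd] := boolp.choice Hg.
have -> : 16 * M / r ^+ 2 * rnorm h ^+ 2 = 2 * (8 * M / r ^+ 2 * rnorm h * rnorm h).
  by ring.
have := @mean_value (fun s => g (z + s *: h) + (0 + - lform c h * s))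
   (fun t => lform (d (z + t%:C *: h)) h + - lform c h)
   (8 * M / r ^+ 2 * rnorm h * rnorm h).
rewrite scale1r scale0r addr0 mulr0 mulr1 !add0r addr0 addrAC; apply.
  move=> t _; apply: cderivD; first exact: cgrad_line.
  exact: cderiv_affine.
move=> t t01.
apply: le_trans (cgrad_lipschitz _ Hg r0 HM (segment_le t01 hr) Hc (Hd _)) _.
have M0 : 0 <= M.
  by apply: le_trans (normc_ge0 _) (HM 0 _); rewrite rnorm0 mulr_ge0// ltW.
rewrite ler_wpM2r ?rnorm_ge0// ler_wpM2l ?segment_le//.
by rewrite divr_ge0// ?mulr_ge0 ?exprn_ge0 ?(ltW r0).
Qed.

(** The limit is the supremum of the s k - b k; every s l + b l is an upper
    bound of these. *)
Lemma real_cauchy (s : nat -> R) (b : nat -> R) :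
  (forall k l, `|s k - s l| <= b k + b l) ->
  exists x, forall k, `|s k - x| <= b k.
Proof.
move=> H.
have ub l : ubound (range (fun k => s k - b k)) (s l + b l).
  by move=> _ [k _ <-]; have := H k l; rewrite ler_norml; lra.
exists (sup (range (fun k => s k - b k))) => k.
have h1 : s k - b k <= sup (range (fun k => s k - b k)).
  by apply: ub_le_sup; [exists (s 0%N + b 0%N); exact: ub|exists k].
have h2 : sup (range (fun k => s k - b k)) <= s k + b k.
  by apply: ge_sup; [exists (s 0%N - b 0%N), 0%N|exact: ub].
by rewrite ler_norml; lra.
Qed.

Lemma complex_cauchy (s : nat -> C) (b : nat -> R) :
  (forall k l, normc (s k - s l) <= b k + b l) ->
  exists x, forall k, normc (s k - x) <= 2 * b k.
Proof.
move=> H.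
have [|x Hx] := @real_cauchy (fun k => complex.Re (s k)) b.
  move=> k l; apply: le_trans (H k l); apply: le_trans (Re_le_normc _).
  by case: (s k) => ? ?; case: (s l).
have [|y Hy] := @real_cauchy (fun k => complex.Im (s k)) b.
  move=> k l; apply: le_trans (H k l); apply: le_trans (Im_le_normc _).
  by case: (s k) => ? ?; case: (s l).
exists (x +i* y) => k; apply: le_trans (normc_le_ReIm _) _.
rewrite mulr2n mulrDl mul1r; move: (Hx k) (Hy k).
by case: (s k) => p q /= ? ?; exact: lerD.
Qed.

Lemma archi_inv (x e : R) : 0 < e -> exists k, x / k.+1%:R <= e.
Proof.
move=> e0; exists (Num.bound (`|x| / e)).
rewrite ler_pdivrMr ?ltr0n// -ler_pdivrMl// mulrC.
apply: (@le_trans _ _ (`|x| / e)).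
  by rewrite ler_wpM2r ?ler_norm// invr_ge0 ltW.
apply: le_trans (ltW (archi_boundP _)) _; first by rewrite divr_ge0// ltW.
by rewrite ler_nat.
Qed.

(** By Cauchy's estimate the gradients of the H k at z form a Cauchy sequence;
    the remainder estimate [second_order] is uniform in k and passes to the
    limit, so the limit of the gradients is the gradient of G. *)
Lemma weierstrass (G : V -> C) (H : nat -> V -> C) z (r M B : R) :
  0 < r -> (forall k, entire (H k)) -> (forall k, ball_bounded (H k) z (3 * r) M) ->
  (forall k h, rnorm h <= 3 * r ->
     normc (G (z + h) - H k (z + h)) <= B / k.+1%:R) ->
  exists c, cgrad G z c.
Proof.
move=> r0 holH bH GH.
have [c Hc] : exists c : nat -> 'I_n -> C, forall k, cgrad (H k) z (c k).
  have [c Hc] := boolp.choice (fun k => holH k z); by exists c.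
pose b k := 2 * (B / k.+1%:R) / (3 * r).
have cau j k l : normc (c k j - c l j) <= b k + b l.
  have r3 : 0 < 3 * r by lra.
  have hol1 : entire (fun x => -1 * H l x + H k x).
    move=> w; have [c1 h1] := holH l w; have [c2 h2] := holH k w.
    by exists (fun j => -1 * c1 j + c2 j); exact: cgrad_comb.
  have b1 : ball_bounded (fun x => -1 * H l x + H k x) z (3 * r)
      (B / k.+1%:R + B / l.+1%:R).
    move=> h hr; rewrite mulN1r.
    rewrite (_ : _ + _ = (G (z + h) - H l (z + h)) - (G (z + h) - H k (z + h)));
      last by ring.
    apply: le_trans (normcB _ _) _; rewrite addrC.
    by apply: lerD; exact: GH.
  have := cauchy_cgrad (delta_mx 0 j) hol1 r3 (cgrad_comb (-1) (Hc l) (Hc k)) b1.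
  rewrite lform_delta mulN1r addrC => /le_trans; apply.
  have E : 2 * (B / k.+1%:R + B / l.+1%:R) / (3 * r) = b k + b l.
    by rewrite /b mulrDr mulrDl.
  rewrite E ler_piMr ?rnorm_delta// -E.
  have := b1 0; rewrite rnorm0 => /(_ (ltW r3)) b2.
  by rewrite divr_ge0 ?(ltW r3)// mulr_ge0// (le_trans (normc_ge0 _) b2).
have [d Hd] := boolp.choice (fun j => complex_cauchy (cau j)).
exists d => e e0.
set K := 16 * M / r ^+ 2.
have K0 : 0 <= K.
  have M0 : 0 <= M.
    by apply: le_trans (normc_ge0 _) (bH 0%N 0 _); rewrite rnorm0 mulr_ge0// ltW.
  by rewrite divr_ge0// ?mulr_ge0 ?exprn_ge0 ?(ltW r0).
exists (Num.min r (e / (K + 1))); first by rewrite lt_min r0 divr_gt0// ltr_wpDl.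
move=> h; rewrite lt_min ltr_pdivlMr ?ltr_wpDl// => /andP[hr he].
have h0 := rnorm_ge0 h.
apply: (@le_trans _ _ (K * rnorm h ^+ 2)); last first.
  by rewrite expr2 mulrA ler_wpM2r//; lra.
apply/ler_addgt0Pr => eta eta0.
set S := 2 * B + \sum_(j < n) (2 * (2 * B / (3 * r)) * rnorm h).
have [k Hk] := archi_inv S eta0.
apply: (@le_trans _ _ (K * rnorm h ^+ 2 + S / k.+1%:R)); last by rewrite lerD2l.
rewrite (_ : _ - _ = (H k (z + h) - H k z - lform (c k) h)
   + ((G (z + h) - H k (z + h)) - (G z - H k z) + (lform (c k) h - lform d h)));
  last by ring.
apply: le_trans (normcD _ _) _; apply: lerD.
  by apply: second_order => //; exact: ltW.
apply: le_trans (normcD _ _) _; rewrite mulrDl; apply: lerD.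
  apply: le_trans (normcB _ _) _.
  rewrite mulr2n !mulrDl mul1r; apply: lerD.
    by apply: GH; lra.
  by have := GH k 0; rewrite rnorm0 addr0; apply; lra.
rewrite -lformB mulr_suml; apply: le_trans (normc_sum _ _) _.
apply: ler_sum => j _; rewrite normcM.
apply: (@le_trans _ _ (2 * b k * rnorm h)).
  by apply: ler_pM => //; [exact: normc_ge0|exact: normc_ge0|exact: rnorm_coord].
rewrite (_ : 2 * b k * rnorm h = 2 * (2 * B / (3 * r)) * rnorm h / k.+1%:R)//.
have : (k.+1%:R : R) != 0 by rewrite pnatr_eq0.
by rewrite /b; move: (k.+1%:R : R) => x x0; field; rewrite x0 gt_eqF.
Qed.

(** The partial derivative is the locally uniform limit of the difference
    quotients of g in the direction e_j, which are entire. *)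
Lemma entire_partial g (G : V -> C) j : entire g ->
  (forall z, exists2 c, cgrad g z c & G z = c j) -> entire G.
Proof.
move=> Hg HG z.
have [c Hc cG] : exists2 c : V -> 'I_n -> C,
    (forall w, cgrad g w (c w)) & (forall w, G w = c w j).
  have /boolp.choice[c Hc] : forall w, exists c, cgrad g w c /\ G w = c j.
    by move=> w; have [d ? ?] := HG w; exists d.
  by exists c => w; have [] := Hc w.
have [r6 [M [r60 HM]]] := entire_locally_bounded z Hg.
(* The estimates at points within 3 r of z involve balls of radius 3 r around
   these points, hence the radius 6 r. *)
pose r := r6 / 6.
have r0 : 0 < r by rewrite divr_gt0.
have r6E : r6 = 6 * r by rewrite /r; field.
have M0 : 0 <= M.
  by apply: le_trans (normc_ge0 _) (HM 0 _); rewrite rnorm0 ltW.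
pose u : V := delta_mx 0 j.
(* N shifts the sequence so that all increments 1 / (k + N + 1) are at most r. *)
have [N HN] := archi_inv 1 r0.
pose a k : C := (k + N).+1%:R.
have na k : normc (a k) = (k + N).+1%:R.
  by rewrite /a -(rmorph_nat (real_complex R)) normc_real ger0_norm.
have a0 k : a k != 0 by rewrite pnatr_eq0.
pose hk k := (a k)^-1 *: u.
have vhk k : rnorm (hk k) <= ((k + N).+1%:R)^-1.
  by rewrite rnormZ normcV na ler_piMr ?rnorm_delta ?invr_ge0.
have vhr k : rnorm (hk k) <= r.
  apply: le_trans (vhk k) _; apply: le_trans HN; rewrite div1r.
  by rewrite lef_pV2 ?posrE// ler_nat ltnS leq_addl.
pose H k w := a k * (g (w + hk k) - g w).
pose B := 16 * M / r ^+ 2.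
have B0 : 0 <= B.
  by rewrite /B; apply: divr_ge0; [exact: mulr_ge0|exact: sqr_ge0].
have GH k h : rnorm h <= 3 * r -> normc (G (z + h) - H k (z + h)) <= B / k.+1%:R.
  move=> h3; have b3 : ball_bounded g (z + h) (3 * r) M.
    by apply: ball_bounded_shift HM _; lra.
  have := second_order Hg r0 b3 (vhr k) (Hc (z + h)).
  rewrite linearZ/= lform_delta -cG => K.
  rewrite /H -normcN opprB.
  rewrite (_ : _ - _ = a k *
     (g (z + h + hk k) - g (z + h) - (a k)^-1 *: G (z + h))); last first.
    by rewrite /GRing.scale/=; field.
  rewrite normcM na.
  apply: le_trans (ler_wpM2l _ K) _ => //; rewrite -/B.
  apply: (@le_trans _ _ ((k + N).+1%:R * (B * ((k + N).+1%:R^-1) ^+ 2))).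
    by rewrite ler_wpM2l// ler_wpM2l// lerXn2r ?nnegrE ?rnorm_ge0 ?invr_ge0.
  rewrite (_ : _ * _ = B / (k + N).+1%:R); last first.
    have : ((k + N).+1%:R : R) != 0 by rewrite pnatr_eq0.
    by move: ((k + N).+1%:R : R) => x x0; field.
  by rewrite ler_wpM2l// lef_pV2 ?posrE// ler_nat ltnS leq_addr.
apply: (@weierstrass G H z r (2 * M / r + B) B) => //.
- move=> k w; have [d Hd] := entire_shiftB (hk k) Hg w.
  exists (fun j => a k * d j + 0).
  have := cgrad_comb (a k) Hd (@cgrad_0 w).
  by under eq_fun do rewrite addr0.
move=> k h h3; rewrite -(subrK (G (z + h)) (H k _)).
apply: le_trans (normcD _ _) _; rewrite addrC; apply: lerD.
  rewrite cG -lform_delta.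
  apply: le_trans (cauchy_cgrad (delta_mx 0 j) Hg r0 (Hc (z + h))
    (ball_bounded_shift HM _)) _; first lra.
  by rewrite ler_piMr ?rnorm_delta// divr_ge0 ?(ltW r0)// mulr_ge0.
rewrite -normcN opprB; apply: le_trans (GH k h h3) _.
by rewrite ler_pdivrMr ?ltr0n// ler_peMr// ler1n.
Qed.

Lemma cgrad_rderive g z c v : cgrad g z c ->
  rderivable g v z /\ rderive v g z = lform c v.
Proof.
move=> Hc; have Hl : cderiv (fun s => g (z + s *: v)) 0 (lform c v).
  by apply: cgrad_line; rewrite scale0r addr0.
have DR := cderiv_Re Hl; have DI := cderiv_Im Hl.
split; first by split; apply: ex_derive.
rewrite /rderive !derive1E (@derive_val _ _ _ _ _ _ _ DR).
by rewrite (@derive_val _ _ _ _ _ _ _ DI); case: (lform c v).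
Qed.

Lemma lform_dirx (c : 'I_n -> C) j : lform c (dirx R j) = c j.
Proof. exact: lform_delta. Qed.

Lemma lform_diry (c : 'I_n -> C) j : lform c (diry R j) = (0 +i* 1) * c j.
Proof. by rewrite /diry linearZ/= lform_delta. Qed.

Lemma entire_rderive_dirx g j : entire g -> entire (rderive (dirx R j) g).
Proof.
move=> Hg; apply: (entire_partial (j := j) Hg) => z; have [c Hc] := Hg z.
exists c => //; have [_ ->] := cgrad_rderive (dirx R j) Hc.
exact: lform_dirx.
Qed.

Lemma entire_rderive_diry g j : entire g ->
  rderive (diry R j) g = fun z => (0 +i* 1) * rderive (dirx R j) g z.
Proof.
move=> Hg; apply/funext => z; have [c Hc] := Hg z.
have [_ ->] := cgrad_rderive (dirx R j) Hc.
have [_ ->] := cgrad_rderive (diry R j) Hc.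
by rewrite lform_dirx lform_diry.
Qed.

Lemma entire_class_C k g : entire g -> class_C k g.
Proof.
elim: k g => [|k IH] g Hg; (split; first exact: entire_continuous) => // j.
have Hx := entire_rderive_dirx j Hg.
split.
- by move=> z; have [c Hc] := Hg z; case: (cgrad_rderive (dirx R j) Hc).
- by move=> z; have [c Hc] := Hg z; case: (cgrad_rderive (diry R j) Hc).
- exact: IH.
rewrite entire_rderive_diry//; apply: IH => z; have [c Hc] := Hx z.
exists (fun i => (0 +i* 1) * c i + 0).
have := cgrad_comb (0 +i* 1) Hc (@cgrad_0 z).
by under eq_fun do rewrite addr0.
Qed.

Lemma entire_dzbar g j : entire g -> dzbar j g = fun=> 0.
Proof.
move=> Hg; apply/funext => z; rewrite /dzbar entire_rderive_diry//.
rewrite mulrA (_ : (0 +i* 1) * (0 +i* 1) = -1); last first.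
  by rewrite -expr2; exact: sqr_i.
by rewrite mulN1r subrr mulr0.
Qed.

Lemma dz0 j z : dz j (fun=> 0 : C) z = 0.
Proof.
have E v : rderive v (fun _ : V => 0 : C) z = 0.
  by rewrite /rderive !derive1_cst.
by rewrite /dz !E mulr0 subrr mulr0.
Qed.

Lemma entire_Delta nu g : entire g -> Delta nu g = fun=> 0.
Proof.
move=> Hg; apply/funext => z; rewrite /Delta big1// => j _.
by rewrite entire_dzbar// dz0 oppr0 mulr0 addr0.
Qed.
End Holomorphic.

(** * A discrete subgroup of full rank spans C^n over the reals *)

(** Pigeonhole: among N'^m + 1 multiples of the vector a, with N' = N + 1, two
    have all fractional parts in the same boxes of side 1 / N'. *)
Lemma dirichlet_approximation (R : realType) (m N : nat) (a : 'I_m -> R) :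
  exists (q : nat) (p : 'I_m -> int), (0 < q)%N /\
    forall i, `|q%:R * a i - (p i)%:~R| <= N.+1%:R^-1.
Proof.
pose fr (x : R) := x - (Num.floor x)%:~R.
have fr01 x : 0 <= fr x < 1.
  have /andP[h1 h2] := floor_itv x; rewrite intrD in h2.
  by rewrite /fr subr_ge0 h1 ltrBlDr addrC.
have N0 : 0 < N.+1%:R :> R by rewrite ltr0n.
pose bx x : 'I_N.+1 := inord (Num.trunc (N.+1%:R * fr x)).
have bxP x : (bx x)%:R <= N.+1%:R * fr x < (bx x)%:R + 1.
  have /andP[f0 f1] := fr01 x.
  have p0 : 0 <= N.+1%:R * fr x by rewrite mulr_ge0// ltW.
  have /andP[t1 t2] := truncn_itv p0.
  rewrite inordK ?t1 -?natr1 // -?(ltr_nat R) ?natr1//.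
  apply: le_lt_trans t1 _; by rewrite -[ltRHS]mulr1 ltr_pM2l.
pose phi (t : 'I_(N.+1 ^ m).+1) := [ffun i => bx (t%:R * a i)].
have [t [t' [tt' E]]] : exists t t' : 'I_(N.+1 ^ m).+1,
    (t < t')%N /\ phi t = phi t'.
  have : ~ injective phi.
    move=> /leq_card; rewrite card_ffun !card_ord ltnn //.
  move=> /existsNP[t /existsNP[t' /not_implyP[E /eqP tt']]].
  have : (t != t' :> nat) by [].
  rewrite neq_ltn => /orP[h|h]; [by exists t, t'|by exists t', t].
exists (t' - t)%N, (fun i => Num.floor (t'%:R * a i) - Num.floor (t%:R * a i)).
split=> [|i]; first by rewrite subn_gt0.
have := bxP (t%:R * a i); have := bxP (t'%:R * a i).
have -> : bx (t'%:R * a i) = bx (t%:R * a i).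
  by have := congr1 (fun f : {ffun _} => f i) E; rewrite !ffunE.
move: (bx _) => b b1 b2.
rewrite natrB ?(ltnW tt')// intrB.
rewrite (_ : _ - _ = fr (t'%:R * a i) - fr (t%:R * a i)); last by rewrite /fr; ring.
rewrite -[leRHS]mul1r ler_pdivlMr// -(ger0_norm (ltW N0)) -normrM.
by rewrite ler_norml; lra.
Qed.

Section Lattice.
Variables (R : realType) (n : nat).
Local Notation C := R[i].
Local Notation V := 'rV[R[i]]_n.
Variable Gamma : set V.
Hypothesis Gamma_lattice : full_rank_lattice Gamma.

Lemma lattice0 : Gamma 0. Proof. by case: Gamma_lattice. Qed.

Lemma latticeB x y : Gamma x -> Gamma y -> Gamma (x - y).
Proof. by case: Gamma_lattice => _ H _ _; exact: H. Qed.

Lemma latticeD x y : Gamma x -> Gamma y -> Gamma (x + y).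
Proof.
move=> Gx Gy; rewrite -[y]opprK; apply: latticeB => //.
by rewrite -sub0r; apply: latticeB => //; exact: lattice0.
Qed.

Lemma lattice_sum (I : Type) (s : seq I) (F : I -> V) :
  (forall i, Gamma (F i)) -> Gamma (\sum_(i <- s) F i).
Proof.
by move=> HF; elim/big_ind : _ => //; [exact: lattice0|exact: latticeD].
Qed.

Lemma latticeMz x (k : int) : Gamma x -> Gamma (x *~ k).
Proof.
move=> Gx.
have Gn (j : nat) : Gamma (x *+ j).
  by elim: j => [|j IH]; [exact: lattice0|rewrite mulrS; exact: latticeD].
case: k => j; first exact: Gn.
by rewrite NegzE mulrNz -sub0r; apply: latticeB; [exact: lattice0|exact: Gn].
Qed.

Lemma lattice_discrete : exists2 dl : R, 0 < dl &
  forall x, Gamma x -> rnorm x < dl -> x = 0.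
Proof.
have [_ _ /(_ 0 lattice0) [_ [U /nbhs_rnormP[dl dl0 H] UG]] _] := Gamma_lattice.
exists dl => // x Gx /H; rewrite add0r => Ux.
by have : (U `&` Gamma) x by []; rewrite UG.
Qed.

Definition realrow (v : V) : 'rV[R]_(n + n) :=
  row_mx (\row_j complex.Re (v 0 j)) (\row_j complex.Im (v 0 j)).

Lemma realrow_inj : injective realrow.
Proof.
move=> v w /eq_row_mx[/rowP hr /rowP hi]; apply/rowP => j.
have := hr j; have := hi j; rewrite !mxE.
by case: (v 0 j) => a b; case: (w 0 j) => c d /= -> ->.
Qed.

Lemma realrow_sum m (a : 'I_m -> R) (e : 'I_m -> V) :
  realrow (\sum_i (a i)%:C *: e i) = (\row_i a i) *m (\matrix_i realrow (e i)).
Proof.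
have add : {morph realrow : x y / x + y}.
  move=> x y; rewrite /realrow add_row_mx; congr row_mx; apply/rowP => j;
  by rewrite !mxE; case: (x 0 j) => ? ?; case: (y 0 j).
have r0 : realrow 0 = 0.
  rewrite /realrow -row_mx0; congr row_mx; apply/rowP => j; by rewrite !mxE.
rewrite (big_morph realrow add r0) mulmx_sum_row; apply: eq_bigr => i _.
rewrite rowK mxE /realrow scale_row_mx; congr row_mx; apply/rowP => j;
by rewrite !mxE; case: (e i 0 j) => p q /=; simpc.
Qed.

(** If the Z-free family e of 2n lattice vectors were dependent over R, some
    e k would be a real combination of a subfamily that avoids it.  Dirichlet
    approximation of the coefficients then produces an arbitrarily short
    lattice vector q e_k - sum_j p_j e_(f j) with q > 0; it is zero by
    discreteness, against Z-freeness. *)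
Lemma lattice_span : exists e : 'I_(2 * n) -> V, (forall i, Gamma (e i)) /\
  forall v, exists a : 'I_(2 * n) -> R, v = \sum_i (a i)%:C *: e i.
Proof.
have [_ _ _ [[e Ge eF] _]] := Gamma_lattice.
exists e; split=> // v.
pose E := \matrix_i realrow (e i).
have [/eqP rE|rE] := eqVneq (\rank E) (n + n)%N.
  have /submxP[D HD] : (realrow v <= E)%MS by exact: submx_full.
  exists (fun i => D 0 i); apply: realrow_inj; rewrite realrow_sum HD.
  by congr (_ *m _); apply/rowP => i; rewrite mxE.
exfalso.
have rlt : (\rank E < 2 * n)%N.
  apply: (@leq_trans (n + n)%N); last by rewrite mul2n addnn.
  by rewrite ltn_neqAle rE rank_leq_col.
pose f := maxrankfun E.
have [k Hk] : exists k, forall j, f j != k.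
  have : ~~ ([set: 'I_(2 * n)]%SET \subset codom f).
    apply: contraL rlt => /subset_leq_card; rewrite cardsT card_ord -leqNgt.
    move=> /leq_trans; apply; apply: leq_trans (leq_image_card _ _) _.
    by rewrite card_ord.
  move=> /subsetPn[k _ kf]; exists k => j.
  by apply: contraNneq kf => <-; exact: codom_f.
have [dl dl0 disc] := lattice_discrete.
have /submxP[D HD] : (realrow (e k) <= rowsub f E)%MS.
  rewrite eq_maxrowsub (_ : realrow (e k) = row k E) ?row_sub//.
  by rewrite rowK.
have ek : e k = \sum_j (D 0 j)%:C *: e (f j).
  apply: realrow_inj; rewrite realrow_sum HD; congr (_ *m _).
    by apply/rowP => i; rewrite mxE.
  by apply/matrixP => i j; rewrite !mxE.
pose S := \sum_j rnorm (e (f j)).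
have S0 : 0 <= S by apply: sumr_ge0 => j _; exact: rnorm_ge0.
have [N HN] := archi_inv (S + 1) dl0.
have [q [p [q0 Hp]]] := dirichlet_approximation N (fun j => D 0 j).
pose x := e k *~ q - \sum_j e (f j) *~ p j.
have Gx : Gamma x.
  apply: latticeB; first exact: latticeMz.
  by apply: lattice_sum => j; exact: latticeMz.
have mulz (w : V) (z : int) : w *~ z = (z%:~R : R)%:C *: w.
  by rewrite -scaler_int; congr (_ *: _); rewrite rmorph_int.
have xE : x = \sum_j (q%:R * D 0 j - (p j)%:~R)%:C *: e (f j).
  rewrite /x {1}ek mulz scaler_sumr -sumrB; apply: eq_bigr => j _.
  by rewrite mulz scalerA -scalerBl rmorphB rmorphM.
have x0 : x = 0.
  apply: disc => //; rewrite xE; apply: le_lt_trans (rnorm_sum _ _) _.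
  apply: (@le_lt_trans _ _ (S / N.+1%:R)).
    rewrite /S mulr_suml; apply: ler_sum => j _; rewrite rnormZ normc_real mulrC.
    by rewrite ler_wpM2l ?rnorm_ge0.
  by apply: lt_le_trans HN; rewrite ltr_pM2r ?invr_gt0 ?ltr0n// ltrDl.
pose c (i : 'I_(2 * n)) : int := (i == k)%:Z * q%:Z - \sum_j (f j == i)%:Z * p j.
have /eF/(_ k) : \sum_i e i *~ c i = 0.
  transitivity x; last exact: x0.
  rewrite /x /c.
  under eq_bigr do rewrite mulrzBr mulrz_sumr.
  rewrite sumrB exchange_big/=; congr (_ - _).
    rewrite (bigD1 k)//= big1 ?addr0 ?eqxx ?mul1r// => i /negPf ->.
    by rewrite mul0r mulr0z.
  apply: eq_bigr => j _.
  rewrite (bigD1 (f j))//= big1 ?addr0 ?eqxx ?mul1r// => i.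
  by rewrite eq_sym => /negPf ->; rewrite mul0r mulr0z.
rewrite /c eqxx mul1r big1 ?subr0 => [|j _]; last first.
  by rewrite (negPf (Hk j)) mul0r.
by move=> [q00]; rewrite q00 in q0.
Qed.
End Lattice.

(** * Real C^1 functions and strict differentiability *)
Section RealCoordinates.
Variables (R : realType) (n : nat).
Local Notation C := R[i].
Local Notation V := 'rV[R[i]]_n.
Local Notation I := (bool * 'I_n)%type.
Implicit Types (v w z h : V) (u : V -> R).

(** The 2n real coordinates of C^n are indexed by a boolean, true for the
    imaginary parts, and a complex coordinate. *)
Definition rdir (c : I) : V := if c.1 then diry R c.2 else dirx R c.2.
Definition rcoord (c : I) v : R :=
  if c.1 then complex.Im (v 0 c.2) else complex.Re (v 0 c.2).

Lemma rcoordD c v w : rcoord c (v + w) = rcoord c v + rcoord c w.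
Proof.
rewrite /rcoord mxE; case: c => -[] j /=;
by case: (v 0 j) => ? ?; case: (w 0 j).
Qed.

Lemma rcoordZ c (a : R) v : rcoord c (a%:C *: v) = a * rcoord c v.
Proof.
rewrite /rcoord mxE; case: c => -[] j /=;
by case: (v 0 j) => ? ? /=; rewrite mul0r ?subr0 ?addr0.
Qed.

Lemma rcoord_sum m c (F : 'I_m -> V) :
  rcoord c (\sum_i F i) = \sum_i rcoord c (F i).
Proof.
apply: big_morph; first exact: rcoordD.
by rewrite -(scale0r 0) -[0 : C]/((0 : R)%:C) rcoordZ mul0r.
Qed.

Lemma rcoord_rdir c d : rcoord c (rdir d) = (c == d)%:R.
Proof.
rewrite /rcoord /rdir; case: c d => b j [b' j']; rewrite xpair_eqE /diry /dirx /=.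
by case: b' => /=; case: b => /=; rewrite !mxE ?eqxx /=; case: (j == j');
  rewrite /= ?mulr0 ?mulr1 ?mul0r ?mul1r ?subr0 ?addr0 ?oppr0 ?add0r.
Qed.

Lemma rcoord_le c v : `|rcoord c v| <= rnorm v.
Proof.
apply: le_trans (rnorm_coord v c.2); rewrite /rcoord.
by case: c.1; [exact: Im_le_normc|exact: Re_le_normc].
Qed.

Lemma rnorm_rdir c : rnorm (rdir c) <= 1.
Proof.
rewrite /rdir; case: c.1; last exact: rnorm_delta.
rewrite /diry rnormZ (_ : normc _ = 1) ?mul1r ?rnorm_delta//.
by rewrite /= expr0n expr1n add0r sqrtr1.
Qed.

Lemma rcoord_dir_sum v : v = \sum_c (rcoord c v)%:C *: rdir c.
Proof.
rewrite (_ : \sum_c _ = \sum_j \sum_b (rcoord (b, j) v)%:C *: rdir (b, j)); last first.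
  by rewrite exchange_big pair_bigA; apply: eq_bigr => -[].
rewrite [LHS]row_sum_delta; apply: eq_bigr => j _.
rewrite big_bool /rcoord /rdir /diry /dirx/= scalerA -scalerDl; congr (_ *: _).
by rewrite addrC mulrC -complexE.
Qed.

Definition rcontinuous u := forall z (e : R), 0 < e ->
  exists2 dl : R, 0 < dl & forall h, rnorm h < dl -> `|u (z + h) - u z| <= e.

Definition C1 u (Du : I -> V -> R) :=
  (forall c z, is_derive (0 : R) 1 (fun t : R => u (z + t%:C *: rdir c)) (Du c z))
  /\ (forall c, rcontinuous (Du c)).

Lemma rcontinuous_fam (F : I -> V -> R) : (forall c, rcontinuous (F c)) ->
  forall z (e : R), 0 < e -> exists2 dl : R, 0 < dl &
    forall c h, rnorm h < dl -> `|F c (z + h) - F c z| <= e.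
Proof.
move=> HF z e e0.
have [D D0 HD] : exists2 D : I -> R, (forall c, 0 < D c) &
    forall c h, rnorm h < D c -> `|F c (z + h) - F c z| <= e.
  have /boolp.choice[D HD] : forall c, exists dl : R, 0 < dl /\
      forall h, rnorm h < dl -> `|F c (z + h) - F c z| <= e.
    by move=> c; have [dl ? ?] := HF c z e e0; exists dl.
  by exists D => c; case: (HD c).
exists (\big[Num.min/1]_c D c).
  by elim/big_ind : _ => // x y x0 y0; rewrite lt_min x0.
by move=> c h hd; apply: HD; apply: lt_le_trans hd _; exact: bigmin_le.
Qed.

Lemma C1_line u Du c z (r t : R) : C1 u Du ->
  is_derive t 1 (fun s : R => u (z + (s * r)%:C *: rdir c))
    (r * Du c (z + (t * r)%:C *: rdir c)).
Proof.
move=> [Hu _]; have := Hu c (z + (t * r)%:C *: rdir c).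
set G := (fun s : R => u _) => HG.
have -> : (fun s : R => u (z + (s * r)%:C *: rdir c)) = G \o (fun s => s * r - t * r).
  apply/funext => s; rewrite /G /=; congr u.
  by rewrite -addrA -scalerDl -rmorphD subrKC.
rewrite (mulrC r (Du _ _)).
apply: (@is_derive1_comp R G (fun s => s * r - t * r) t _ r).
  by rewrite [X in is_derive X _ _ _]subrr.
apply: is_derive_eq; rewrite /GRing.scale/=; ring.
Qed.

(** Moving from w to w + v one real coordinate at a time, each step is a mean
    value inequality with a partial derivative that is close to its value at
    z.  The estimate is uniform in the base point w near z. *)
Lemma strict_diff u Du : C1 u Du -> forall z (e : R), 0 < e ->
  exists2 dl : R, 0 < dl & forall w v, rnorm (w - z) < dl -> rnorm v < dl ->
    `|u (w + v) - u w - \sum_c rcoord c v * Du c z| <= e * rnorm v.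
Proof.
move=> HC z e e0.
have cI0 : 0 < (#|{: I}|.+1)%:R :> R by rewrite ltr0n.
set e1 := e / (#|{: I}|.+1)%:R.
have e10 : 0 < e1 by rewrite divr_gt0.
have [dl0 dl00 H] := rcontinuous_fam HC.2 z e10.
(* All intermediate points stay within (#|I| + 2) * dl = dl0 of z. *)
exists (dl0 / (#|{: I}|.+2)%:R); first by rewrite divr_gt0// ltr0n.
set dl := _ / _; have dlE : dl0 = dl * (#|{: I}|.+2)%:R.
  by rewrite /dl divfK// pnatr_eq0.
move=> w v wd vd; have v0 := rnorm_ge0 v.
(* The partial sums of the coordinate expansion of v. *)
have step (s : seq I) : (size s <= #|{: I}|)%N ->
  `|u (w + \sum_(c <- s) (rcoord c v)%:C *: rdir c) - u w
     - \sum_(c <- s) rcoord c v * Du c z| <= (size s)%:R * e1 * rnorm v.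
  elim: s => [|c s IH] hs.
    by rewrite !big_nil addr0 subrr subr0 normr0 !mul0r.
  rewrite !big_cons; set W := \sum_(c <- s) (rcoord c v)%:C *: rdir c in IH *.
  set T := \sum_(c <- s) _ in IH *.
  have := IH (ltnW hs); set r := rcoord c v => {}IH.
  have WE : rnorm W <= (size s)%:R * rnorm v.
    apply: le_trans (rnorm_sum _ _) _.
    apply: (@le_trans _ _ (\sum_(c <- s) rnorm v)).
      apply: ler_sum => d _; rewrite rnormZ normc_real -[leRHS]mulr1.
      by apply: ler_pM => //; [exact: rnorm_ge0|exact: rcoord_le|exact: rnorm_rdir].
    by rewrite big_const_seq count_predT iter_addr_0 mulr_natl.
  have pt (t : R) : 0 <= t <= 1 ->
      `|r * Du c (w + W + (t * r)%:C *: rdir c) - r * Du c z| <= e1 * rnorm v.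
    move=> /andP[t0 t1]; rewrite -mulrBr normrM mulrC.
    have rv : `|r| <= rnorm v by exact: rcoord_le.
    apply: ler_pM => //.
    rewrite (_ : w + W + _ = z + ((w - z) + (W + (t * r)%:C *: rdir c))); last first.
      by rewrite !addrA [z + w]addrC addrK.
    apply: H; apply: le_lt_trans (rnormD _ _) _.
    have E1 : rnorm (W + (t * r)%:C *: rdir c) <= (size s)%:R * rnorm v + rnorm v.
      apply: le_trans (rnormD _ _) _; apply: lerD => //.
      rewrite rnormZ normc_real normrM ger0_norm//.
      apply: le_trans rv; rewrite -[leRHS]mulr1; apply: ler_pM.
      - exact: mulr_ge0.
      - exact: rnorm_ge0.
      - by rewrite ler_piMl.
      - exact: rnorm_rdir.
    have E2 : (size s)%:R * rnorm v + rnorm v <= #|{: I}|%:R * rnorm v.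
      by rewrite -[X in _ + X]mul1r -mulrDl natr1 ler_wpM2r// ler_nat.
    have E3 : #|{: I}|%:R * rnorm v <= #|{: I}|%:R * dl.
      by rewrite ler_wpM2l// ltW.
    have E4 : dl0 = #|{: I}|%:R * dl + 2 * dl.
      by rewrite dlE -!natr1; ring.
    have dlp : 0 <= dl by apply: le_trans v0 (ltW vd).
    lra.
  have := @increment_le R (fun t => u (w + W + (t * r)%:C *: rdir c))
    (fun t => r * Du c (w + W + (t * r)%:C *: rdir c))
    (fun t => t * (r * Du c z)) (fun=> r * Du c z) 0 1 (e1 * rnorm v) ler01.
  move=> K.
  have {K} := K (fun t _ => C1_line c (w + W) r t HC) _ pt.
  rewrite !mul1r !mul0r scale0r !addr0 !subr0 mulr1 => K.
  have {}K : `|u (w + W + r%:C *: rdir c) - u (w + W) - r * Du c z| <= e1 * rnorm v.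
    apply: K => t _; apply: is_derive_eq; rewrite /GRing.scale/=; ring.
  rewrite (addrC (r%:C *: _)) addrA.
  rewrite (_ : _ - _ = (u (w + W + r%:C *: rdir c) - u (w + W) - r * Du c z)
     + (u (w + W) - u w - T)); last by ring.
  apply: le_trans (ler_normD _ _) _.
  apply: le_trans (lerD K IH) _.
  by rewrite /= -natr1; lra.
have := step (index_enum I).
have -> : size (index_enum I) = #|{: I}| by rewrite cardT enumT.
move=> /(_ (leqnn _)); rewrite -[\sum_(c <- _) _ *: _]rcoord_dir_sum => K.
apply: le_trans K _; rewrite ler_wpM2r// /e1 mulrC -mulrA ler_piMr ?(ltW e0)//.
by rewrite mulrC ler_pdivrMr// mul1r ler_nat.
Qed.
End RealCoordinates.

(** * Periodic fields with nonnegative divergence *)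

(** X is a real vector field with components X c in the coordinate directions,
    DX c d is the derivative of X c along d, and the e i are periods of X that
    span C^n; A expresses the coordinate directions through the periods. *)
Section PeriodicDivergence.
Variables (R : realType) (n m : nat).
Local Notation C := R[i].
Local Notation V := 'rV[R[i]]_n.
Local Notation I := (bool * 'I_n)%type.
Variables (e : 'I_m -> V) (A : I -> 'I_m -> R).
Variables (X : I -> V -> R) (DX : I -> I -> V -> R).
Hypothesis HA : forall c, rdir R c = \sum_i (A c i)%:C *: e i.
Hypothesis HX : forall c, C1 (X c) (DX c).
Hypothesis Xper : forall c i z, X c (z + e i) = X c z.

Let f z := \sum_c DX c c z.

Let contf : rcontinuous f.
Proof.
move=> z eps eps0.
have c0 : 0 < (#|{: I}|.+1)%:R :> R by rewrite ltr0n.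
have e0 : 0 < eps / (#|{: I}|.+1)%:R by rewrite divr_gt0.
have [dl dl0 H] := rcontinuous_fam (fun c => (HX c).2 c) z e0.
exists dl => // h hd; rewrite /f -sumrB; apply: le_trans (ler_norm_sum _ _ _) _.
apply: le_trans (ler_sum _ (fun c _ => H c h hd)) _.
rewrite sumr_const -[leLHS]mulr_natl mulrCA ler_piMr ?(ltW eps0)//.
by rewrite ler_pdivrMr// mul1r ler_nat.
Qed.

Let E := \sum_i rnorm (e i).

Let E0 : 0 <= E. Proof. by apply: sumr_ge0 => i _; exact: rnorm_ge0. Qed.

Let rnorm_comb (t : 'I_m -> R) (b : R) : (forall i, `|t i| <= b) ->
  rnorm (\sum_i (t i)%:C *: e i) <= b * E.
Proof.
move=> tb; apply: le_trans (rnorm_sum _ _) _; rewrite /E mulr_sumr.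
by apply: ler_sum => i _; rewrite rnormZ normc_real ler_wpM2r ?rnorm_ge0.
Qed.

(** The divergence is h^-1 times a combination of increments of X along h e_i,
    up to an error that is small locally uniformly: the coefficients A turn
    derivatives along the e i into derivatives along the coordinates. *)
Let local_error p (eps : R) : 0 < eps -> exists2 dl : R, 0 < dl &
  forall w h, rnorm (w - p) < dl -> 0 < h -> h < dl ->
  `|\sum_c \sum_i A c i * (X c (w + h%:C *: e i) - X c w) - h * f w|
    <= eps * h.
Proof.
move=> eps0; pose S := \sum_c \sum_i `|A c i| * rnorm (e i).
have S0 : 0 <= S.
  by apply: sumr_ge0 => c _; apply: sumr_ge0 => i _; rewrite mulr_ge0// rnorm_ge0.
have e1 : 0 < eps / 2 / (S + 1) by rewrite !divr_gt0// ltr_wpDl.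
have e2 : 0 < eps / 2 by rewrite divr_gt0.
have [D D0 HD] : exists2 D : I -> R, (forall c, 0 < D c) & forall c w v,
    rnorm (w - p) < D c -> rnorm v < D c ->
    `|X c (w + v) - X c w - \sum_d rcoord d v * DX c d p|
      <= eps / 2 / (S + 1) * rnorm v.
  have /boolp.choice[D HD] : forall c, exists dl : R, 0 < dl /\ forall w v,
      rnorm (w - p) < dl -> rnorm v < dl ->
      `|X c (w + v) - X c w - \sum_d rcoord d v * DX c d p|
        <= eps / 2 / (S + 1) * rnorm v.
    by move=> c; have [dl ? ?] := strict_diff (HX c) p e1; exists dl.
  by exists D => c; case: (HD c).
have [d1 d10 H1] := contf p e2.
pose d2 := \big[Num.min/1]_c D c.
have d20 : 0 < d2 by rewrite /d2; elim/big_ind : _ => // x y x0 y0; rewrite lt_min x0.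
exists (Num.min (Num.min d1 d2) (d2 / (E + 1))).
  by rewrite !lt_min d10 d20 divr_gt0// ltr_wpDl.
move=> w h; rewrite !lt_min => /andP[/andP[w1 w2] _] h0 /andP[_ hd].
have lin : \sum_c \sum_i A c i * (\sum_d rcoord d (h%:C *: e i) * DX c d p) = h * f p.
  rewrite /f mulr_sumr; apply: eq_bigr => c _.
  under eq_bigr do rewrite mulr_sumr.
  rewrite exchange_big/=.
  transitivity (\sum_d h * DX c d p * rcoord d (rdir R c)).
    apply: eq_bigr => d _; rewrite HA rcoord_sum mulr_sumr; apply: eq_bigr => i _.
    by rewrite !rcoordZ; ring.
  rewrite (bigD1 c)//= rcoord_rdir eqxx mulr1 big1 ?addr0// => d dc.
  by rewrite rcoord_rdir (negPf dc) mulr0.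
rewrite (_ : _ - _ = \sum_c \sum_i A c i * (X c (w + h%:C *: e i) - X c w
    - \sum_d rcoord d (h%:C *: e i) * DX c d p) - h * (f w - f p)); last first.
  rewrite mulrBr -lin opprB addrA; congr (_ - _).
  rewrite -big_split/=; apply: eq_bigr => c _.
  by rewrite -big_split/=; apply: eq_bigr => i _; ring.
apply: le_trans (ler_normB _ _) _.
have -> : eps * h = eps / 2 * h + h * (eps / 2) by field.
apply: lerD; last first.
  rewrite normrM gtr0_norm// ler_wpM2l ?(ltW h0)//.
  by have := H1 (w - p) w1; rewrite subrKC.
apply: (@le_trans _ _ (eps / 2 / (S + 1) * h * S)); last first.
  rewrite mulrAC ler_wpM2r ?(ltW h0)// mulrAC ler_pdivrMr ?ltr_wpDl//.
  by rewrite ler_wpM2l ?(ltW e2)// lerDl.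
apply: le_trans (ler_norm_sum _ _ _) _; rewrite mulr_sumr.
apply: ler_sum => c _.
apply: le_trans (ler_norm_sum _ _ _) _; rewrite mulr_sumr.
apply: ler_sum => i _; rewrite normrM mulrCA ler_wpM2l//.
have vh : rnorm (h%:C *: e i) = h * rnorm (e i) by rewrite rnormZ normc_real gtr0_norm.
have dD : d2 <= D c by exact: bigmin_le.
have := HD c w (h%:C *: e i); rewrite vh mulrA; apply.
  exact: lt_le_trans w2 dD.
apply: lt_le_trans dD; move: hd; rewrite ltr_pdivlMr ?ltr_wpDl//.
apply: le_lt_trans; rewrite ler_wpM2l ?(ltW h0)// /E (bigD1 i)//=.
by rewrite -addrA lerDl addr_ge0// sumr_ge0// => j _; exact: rnorm_ge0.
Qed.

Let pt z0 (t : 'I_m -> R) := z0 + \sum_i (t i)%:C *: e i.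

(** The fundamental cell is compact, so the local error bound is uniform on
    it. *)
Let uniform_error z0 (eps : R) : 0 < eps -> exists N0, forall N t,
  (N0 <= N)%N -> (forall i, 0 <= t i <= 1) ->
  `|\sum_c \sum_i A c i * (X c (pt z0 t + (N.+1%:R^-1)%:C *: e i) - X c (pt z0 t))
     - N.+1%:R^-1 * f (pt z0 t)| <= eps * N.+1%:R^-1.
Proof.
move=> eps0.
pose K := [set t : 'rV[R]_m | forall i, `[0, 1]%classic (t ord0 i)].
have cK : compact K.
  exact: (@rV_compact R m (fun=> `[0, 1]%classic) (fun=> @segment_compact R 0 1)).
pose Q N (t : 'rV[R]_m) :=
  `|\sum_c \sum_i A c i * (X c (pt z0 (t 0) + (N.+1%:R^-1)%:C *: e i) - X c (pt z0 (t 0)))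
     - N.+1%:R^-1 * f (pt z0 (t 0))| <= eps * N.+1%:R^-1.
have /compact_near_coveringP/(_ nat \oo Q _) cov := cK.
have [|N0 _ HN0] := cov.
  move=> t0 _; have [dl dl0 H] := local_error (pt z0 (t0 0)) eps0.
  have [N1 HN1] := archi_inv (2 : R) dl0.
  exists (ball t0 (dl / (E + 1)), [set N | (N1 <= N)%N]).
    split; last exact: nbhs_infty_ge.
    by apply: nbhsx_ballx; rewrite divr_gt0// ltr_wpDl.
  move=> [t N] /= [tb NN]; apply: H; last 2 first.
  - by rewrite invr_gt0 ltr0n.
  - apply: lt_le_trans HN1; apply: (@lt_le_trans _ _ (2 / N.+1%:R)).
      by rewrite -[ltLHS]mul1r ltr_pM2r ?invr_gt0 ?ltr0n// ltr1n.
    by rewrite ler_wpM2l// lef_pV2 ?posrE ?ltr0n// ler_nat.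
  rewrite /pt opprD addrACA subrr add0r -sumrB.
  under eq_bigr do rewrite -scalerBl -rmorphB.
  apply: le_lt_trans (rnorm_comb (b := dl / (E + 1)) _) _.
    move=> i; have := tb.2 0 i; rewrite /ball/= distrC; exact: ltW.
  by rewrite mulrAC ltr_pdivrMr ?ltr_wpDl// ltr_pM2l// ltrDl.
exists N0 => N t N0N t01; have := HN0 N N0N (\row_i t i).
rewrite /Q (_ : (\row_i t i) 0 = t); last by apply/funext => i; rewrite mxE.
by apply => i /=; rewrite mxE in_itv/=.
Qed.

(** A step of length 1/N along e i permutes the grid points modulo periods, so
    the increments of a periodic function over the whole grid sum to zero. *)
Let grid_sum z0 N :
  \sum_(k : {ffun 'I_m -> 'I_N.+1})
    \sum_c \sum_i A c i *
      (X c (pt z0 (fun j => (k j)%:R / N.+1%:R) + (N.+1%:R^-1)%:C *: e i)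
       - X c (pt z0 (fun j => (k j)%:R / N.+1%:R))) = 0.
Proof.
pose g (k : {ffun 'I_m -> 'I_N.+1}) j : R := (k j)%:R / N.+1%:R.
pose sh i (k : {ffun 'I_m -> 'I_N.+1}) := [ffun j => if j == i then ordS (k j) else k j].
have sh_inj i : injective (sh i).
  move=> k k' /ffunP H; apply/ffunP => j; have := H j; rewrite !ffunE.
  by case: eqP => // _; exact: ordS_inj.
have N0 : N.+1%:R != 0 :> R by rewrite pnatr_eq0.
have Xsh c i k : X c (pt z0 (g k) + (N.+1%:R^-1)%:C *: e i) = X c (pt z0 (g (sh i k))).
  have D : pt z0 (g (sh i k)) = pt z0 (g k) + (g (sh i k) i - g k i)%:C *: e i.
    rewrite /pt -addrA; congr (_ + _).
    rewrite (bigD1 i)//= [in RHS](bigD1 i)//= addrAC -scalerDl -rmorphD subrKC.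
    congr (_ + _); apply: eq_bigr => j ji.
    by rewrite /g /sh ffunE (negPf ji).
  have gi : g (sh i k) i = (((k i).+1 %% N.+1)%N)%:R / N.+1%:R.
    by rewrite /g /sh ffunE eqxx.
  (* Either the step stays in the cell, or it leaves it and a period is removed. *)
  have [kN|kN] := ltnP (k i).+1 N.+1.
    have hE : g (sh i k) i - g k i = N.+1%:R^-1.
      by rewrite gi modn_small// /g -mulrBl -natrB ?leqnSn// subSnn mul1r.
    by rewrite D hE.
  have kE : (k i).+1 = N.+1 by apply/eqP; rewrite eqn_leq kN ltn_ord.
  rewrite -[RHS](Xper c i) D -(addrA (pt z0 (g k))); congr (X c (_ + _)).
  have e1 : e i = (1 : C) *: e i by rewrite scale1r.
  rewrite [X in _ = _ + X]e1 -scalerDl; congr (_ *: _).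
  rewrite gi kE modnn mul0r sub0r /g -(rmorph1 (real_complex R)) -rmorphD; congr (_%:C).
  by move/eqP: kE; rewrite eqSS => /eqP ->; rewrite -natr1; field; rewrite natr1.
rewrite exchange_big/= big1// => c _; rewrite exchange_big/= big1// => i _.
rewrite -mulr_sumr sumrB.
rewrite [X in X - _](_ : _ = \sum_k X c (pt z0 (g k))) ?subrr ?mulr0//.
by rewrite [RHS](reindex_inj (sh_inj i)); apply: eq_bigr => k _; exact: Xsh.
Qed.

(** Suppose f(z0) = eta > 0 and take the grid with base point z0 and N = q L.
    The L^m grid points whose indices are all below L are close to z0, so they
    contribute at least L^m eta / 2 to the sum of f >= 0.  The whole sum is at
    most N^m eps because the increments telescope, and
    eps = eta / (4 q^m) makes this L^m eta / 4. *)
Lemma periodic_divergence_eq0 : (forall z, 0 <= f z) -> forall z, f z = 0.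
Proof.
move=> f0 z0; apply/eqP/negPn/negP => fz.
have {fz}eta0 : 0 < f z0 by rewrite lt_def fz f0.
set eta := f z0 in eta0.
have eta2 : 0 < eta / 2 by rewrite divr_gt0.
have [dl dl0 Hdl] := contf z0 eta2.
have [q' Hq] := archi_inv (E + 1) dl0; set q := q'.+1 in Hq.
have q0 : 0 < q%:R :> R by rewrite ltr0n.
have eps0 : 0 < eta / (4 * q%:R ^+ m) by rewrite divr_gt0// mulr_gt0// exprn_gt0.
have [N0 HN0] := uniform_error z0 eps0.
set eps := _ / _ in eps0 HN0.
pose L := N0.+1; pose N := (q * L).-1.
have NE : N.+1 = (q * L)%N by [].
have LN : (L <= N.+1)%N by rewrite NE leq_pmull.
have N1 : 0 < N.+1%:R :> R by rewrite ltr0n.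
have NN0 : (N0 <= N)%N.
  by rewrite -ltnS NE; apply: leq_trans (leq_pmull _ _).
pose g (k : {ffun 'I_m -> 'I_N.+1}) j : R := (k j)%:R / N.+1%:R.
have up : \sum_k f (pt z0 (g k)) <= (N.+1 ^ m)%:R * eps.
  rewrite -(ler_pM2l (_ : 0 < N.+1%:R^-1)) ?invr_gt0// mulr_sumr.
  rewrite -[leLHS]subr0 -[X in _ - X <= _](grid_sum z0 N) -sumrB.
  apply: (@le_trans _ _ (\sum_(k : {ffun 'I_m -> 'I_N.+1}) eps * N.+1%:R^-1)).
    apply: ler_sum => k _; apply: le_trans (ler_norm _) _; rewrite distrC.
    apply: HN0 => // i; rewrite divr_ge0//= ler_pdivrMr// mul1r ler_nat.
    exact: ltnW.
  by rewrite sumr_const card_ffun !card_ord -[leLHS]mulr_natl mulrA mulrC.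
have low : (L ^ m)%:R * (eta / 2) <= \sum_k f (pt z0 (g k)).
  pose B := [pred k : {ffun 'I_m -> 'I_N.+1} |
    k \in ffun_on [pred x : 'I_N.+1 | (x < L)%N]].
  rewrite (bigID B)/=.
  apply: (@le_trans _ _ (\sum_(k in B) eta / 2)).
    rewrite sumr_const -[leRHS]mulr_natl ler_wpM2r ?(ltW eta2)// ler_nat.
    rewrite card_ffun_on card_ord.
    suff -> : #|[pred x : 'I_N.+1 | (x < L)%N]| = L by [].
    by rewrite -sum1_card (big_ord_narrow LN) sum1_card card_ord.
  rewrite -[leLHS]addr0; apply: lerD; last by apply: sumr_ge0 => k _; exact: f0.
  apply: ler_sum => k /ffun_onP kB.
  have := Hdl (\sum_i (g k i)%:C *: e i).
  rewrite -/(pt _ _) => K.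
  suff /K : rnorm (\sum_i (g k i)%:C *: e i) < dl.
    by rewrite ler_norml /eta; lra.
  apply: le_lt_trans (rnorm_comb (b := q%:R^-1) _) _.
    move=> i; rewrite ger0_norm ?divr_ge0//.
    have -> : g k i = (k i)%:R / (q%:R * L%:R) by rewrite /g -natrM -NE.
    rewrite invfM mulrCA.
    rewrite ler_piMr ?invr_ge0// ler_pdivrMr ?ltr0n// mul1r ler_nat.
    exact: ltnW (kB i).
  apply: lt_le_trans Hq; rewrite mulrC ltr_pM2r ?invr_gt0// ltrDl//.
have L0 : 0 < (L ^ m)%:R :> R by rewrite ltr0n expn_gt0.
have := le_trans low up.
rewrite NE expnMn natrM (natrX _ q m) /eps.
rewrite (_ : _ * _ * _ = (L ^ m)%:R * (eta / 4)); last first.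
  by field; rewrite expf_neq0// gt_eqF.
rewrite ler_pM2l//; lra.
Qed.
End PeriodicDivergence.

(** * Calculus of C^1 functions and the Cauchy-Riemann equations *)
Section C1Calculus.
Variables (R : realType) (n : nat).
Local Notation C := R[i].
Local Notation V := 'rV[R[i]]_n.
Local Notation I := (bool * 'I_n)%type.
Implicit Types (v w z h : V) (u : V -> R) (g : V -> C).

Lemma Re_sum (J : Type) (s : seq J) (F : J -> C) :
  complex.Re (\sum_(j <- s) F j) = \sum_(j <- s) complex.Re (F j).
Proof. by apply: big_morph => // -[? ?] [? ?]. Qed.

Lemma Im_sum (J : Type) (s : seq J) (F : J -> C) :
  complex.Im (\sum_(j <- s) F j) = \sum_(j <- s) complex.Im (F j).
Proof. by apply: big_morph => // -[? ?] [? ?]. Qed.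

Lemma rcontinuousP u : rcontinuous u <-> continuous u.
Proof.
split=> [H z|cu z e e0].
  apply/(cvgrPdist_le (F := nbhs z)) => e e0; have [dl dl0 Hd] := H z e e0.
  by apply/nbhs_rnormP; exists dl => // h /Hd; rewrite distrC.
have /cvgrPdist_le/(_ e e0)/nbhs_rnormP[dl dl0 H] := cu z.
by exists dl => // h /H; rewrite distrC.
Qed.

Lemma rcontinuousD u1 u2 : rcontinuous u1 -> rcontinuous u2 ->
  rcontinuous (fun z => u1 z + u2 z).
Proof.
move=> /rcontinuousP h1 /rcontinuousP h2; apply/rcontinuousP => z.
exact: (cvgD (h1 z) (h2 z)).
Qed.

Lemma rcontinuousM u1 u2 : rcontinuous u1 -> rcontinuous u2 ->
  rcontinuous (fun z => u1 z * u2 z).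
Proof.
move=> /rcontinuousP h1 /rcontinuousP h2; apply/rcontinuousP => z.
exact: (cvgM (h1 z) (h2 z)).
Qed.

Lemma rcontinuous_cst (k : R) : rcontinuous (fun _ : V => k).
Proof. by move=> z e e0; exists 1 => // h _; rewrite subrr normr0; exact: ltW. Qed.

Lemma C1_cont u Du : C1 u Du -> rcontinuous u.
Proof.
move=> HC z e e0; have [dl dl0 H] := strict_diff HC z ltr01.
pose S := \sum_c `|Du c z|.
have S0 : 0 <= S by apply: sumr_ge0.
exists (Num.min dl (e / (S + 1))).
  by rewrite lt_min dl0 divr_gt0// ltr_wpDl.
move=> h; rewrite lt_min ltr_pdivlMr ?ltr_wpDl// => /andP[h1 h2].
have := H z h; rewrite subrr rnorm0 => /(_ dl0 h1); rewrite mul1r => K.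
have K2 : `|\sum_c rcoord c h * Du c z| <= S * rnorm h.
  apply: le_trans (ler_norm_sum _ _ _) _; rewrite mulr_suml.
  by apply: ler_sum => c _; rewrite normrM mulrC ler_wpM2l// rcoord_le.
rewrite -(subrK (\sum_c rcoord c h * Du c z) (u (z + h) - u z)).
by apply: le_trans (ler_normD _ _) _; lra.
Qed.

Lemma C1D u1 u2 D1 D2 : C1 u1 D1 -> C1 u2 D2 ->
  C1 (fun z => u1 z + u2 z) (fun c z => D1 c z + D2 c z).
Proof.
move=> H1 H2; split=> [c z|c]; last by apply: rcontinuousD; [exact: H1.2|exact: H2.2].
by apply: is_deriveD; [exact: H1.1|exact: H2.1].
Qed.

Lemma C1M u1 u2 D1 D2 : C1 u1 D1 -> C1 u2 D2 ->
  C1 (fun z => u1 z * u2 z) (fun c z => u1 z * D2 c z + u2 z * D1 c z).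
Proof.
move=> H1 H2; split=> [c z|c].
  have z0 : z + (0 : R)%:C *: rdir R c = z by rewrite scale0r addr0.
  apply: (is_derive_eq (is_deriveM (H1.1 c z) (H2.1 c z))).
  rewrite -[LHS]/(u1 (z + (0 : R)%:C *: rdir R c) * D2 c z
    + u2 (z + (0 : R)%:C *: rdir R c) * D1 c z).
  by rewrite z0.
by apply: rcontinuousD; apply: rcontinuousM;
  [exact: C1_cont H1|exact: H2.2|exact: C1_cont H2|exact: H1.2].
Qed.

Lemma C1_cst (k : R) : C1 (fun _ : V => k) (fun _ _ => 0).
Proof. by split=> [c z|c]; [exact: is_derive_cst|exact: rcontinuous_cst]. Qed.

Lemma C1Z (k : R) u Du : C1 u Du -> C1 (fun z => k * u z) (fun c z => k * Du c z).
Proof.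
move=> /(C1M (C1_cst k)); congr C1; apply/funext => c; apply/funext => z.
by rewrite mulr0 addr0.
Qed.

Lemma C1_sum (J : Type) (s : seq J) (u : J -> V -> R) (Du : J -> I -> V -> R) :
  (forall j, C1 (u j) (Du j)) ->
  C1 (fun z => \sum_(j <- s) u j z) (fun c z => \sum_(j <- s) Du j c z).
Proof.
move=> H; elim: s => [|j s IH].
  under eq_fun do rewrite big_nil.
  under [X in C1 _ X]funext => c do under eq_fun do rewrite big_nil.
  exact: C1_cst.
under eq_fun do rewrite big_cons.
under [X in C1 _ X]funext => c do under eq_fun do rewrite big_cons.
exact: C1D.
Qed.

Lemma C1_rcoord d : C1 (@rcoord R n d) (fun c _ => (d == c)%:R).
Proof.
split=> [c z|c]; last exact: rcontinuous_cst.
under eq_fun do rewrite rcoordD rcoordZ rcoord_rdir.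
apply: is_derive_eq; rewrite /GRing.scale/= ?mulr0 ?mulr1 ?add0r; ring.
Qed.

Lemma C1_expR u Du : C1 u Du ->
  C1 (fun z => expR (u z)) (fun c z => expR (u z) * Du c z).
Proof.
move=> HC; split=> [c z|c].
  apply: (@is_derive1_comp R expR (fun t => u (z + t%:C *: rdir R c))).
    by rewrite scale0r addr0; exact: is_derive_expR.
  exact: HC.1.
apply: rcontinuousM; last exact: HC.2.
have /rcontinuousP cu := C1_cont HC.
apply/rcontinuousP => z; apply: continuous_comp; first exact: cu.
exact: continuous_expR.
Qed.

Lemma class_C1_Re g : class_C 1 g ->
  C1 (fun z => complex.Re (g z)) (fun c z => complex.Re (rderive (rdir R c) g z)).
Proof.
move=> [cg Hg]; split=> [[b j] z|[b j]].
  have [Hx Hy _ _] := Hg j.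
  have [D _] : rderivable g (rdir R (b, j)) z by case: b; [exact: Hy|exact: Hx].
  by rewrite /= derive1E; exact: derivableP.
have [_ _ [cx _] [cy _]] := Hg j.
have {cx cy} : continuous (rderive (rdir R (b, j)) g) by case: b; [exact: cy|exact: cx].
move=> /continuousP_rnorm H z e e0; have [dl dl0 Hd] := H z e e0.
exists dl => // h /Hd; apply: le_trans; apply: le_trans (Re_le_normc _).
by case: (rderive _ _ _) => ? ?; case: (rderive _ _ _).
Qed.

Lemma class_C1_Im g : class_C 1 g ->
  C1 (fun z => complex.Im (g z)) (fun c z => complex.Im (rderive (rdir R c) g z)).
Proof.
move=> [cg Hg]; split=> [[b j] z|[b j]].
  have [Hx Hy _ _] := Hg j.
  have [_ D] : rderivable g (rdir R (b, j)) z by case: b; [exact: Hy|exact: Hx].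
  by rewrite /= derive1E; exact: derivableP.
have [_ _ [cx _] [cy _]] := Hg j.
have {cx cy} : continuous (rderive (rdir R (b, j)) g) by case: b; [exact: cy|exact: cx].
move=> /continuousP_rnorm H z e e0; have [dl dl0 Hd] := H z e e0.
exists dl => // h /Hd; apply: le_trans; apply: le_trans (Im_le_normc _).
by case: (rderive _ _ _) => ? ?; case: (rderive _ _ _).
Qed.

Lemma C1_rderive g P Q c z :
  C1 (fun z => complex.Re (g z)) P -> C1 (fun z => complex.Im (g z)) Q ->
  rderive (rdir R c) g z = P c z +i* Q c z.
Proof.
move=> HP HQ; rewrite /rderive !derive1E.
rewrite (@derive_val _ _ _ _ _ _ _ (HP.1 c z)).
by rewrite (@derive_val _ _ _ _ _ _ _ (HQ.1 c z)).
Qed.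

Lemma dzbar_ReIm j g z : dzbar j g z =
  (2^-1 * (complex.Re (rderive (dirx R j) g z)
           + -1 * complex.Im (rderive (diry R j) g z))) +i*
  (2^-1 * (complex.Im (rderive (dirx R j) g z)
           + complex.Re (rderive (diry R j) g z))).
Proof.
rewrite /dzbar -[2^-1 : C](_ : (2^-1 : R)%:C = _); last first.
  by rewrite fmorphV rmorph_nat.
case: (rderive (dirx R j) g z) => x y.
case: (rderive (diry R j) g z) => x' y' /=.
by simpc; congr (_ +i* _); ring.
Qed.

Lemma class_C1_dzbar g j : class_C 2 g -> exists P Q,
  C1 (fun z => complex.Re (dzbar j g z)) P /\
  C1 (fun z => complex.Im (dzbar j g z)) Q.
Proof.
move=> [_ /(_ j)[_ _ Hx Hy]].
have Rx := class_C1_Re Hx; have Ix := class_C1_Im Hx.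
have Ry := class_C1_Re Hy; have Iy := class_C1_Im Hy.
have E := dzbar_ReIm j g.
have := C1Z 2^-1 (C1D Rx (C1Z (-1) Iy)); have := C1Z 2^-1 (C1D Ix Ry).
set DQ := (X in C1 _ X); set F := (X in C1 X DQ) => HQ.
set DP := (X in C1 _ X); set G := (X in C1 X DP) => HP.
exists DP, DQ; split.
  by rewrite (_ : (fun z => _) = G)//; apply/funext => z; rewrite E.
by rewrite (_ : (fun z => _) = F)//; apply/funext => z; rewrite E.
Qed.

(** C^1 functions have a real differential by [strict_diff]; it is complex
    linear because dg/dy_j = i dg/dx_j. *)
Lemma cauchy_riemann_cgrad g z : class_C 1 g -> (forall j, dzbar j g z = 0) ->
  exists c, cgrad g z c.
Proof.
move=> Hg CR; have HR := class_C1_Re Hg; have HI := class_C1_Im Hg.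
exists (fun j => rderive (dirx R j) g z) => e e0.
have e2 : 0 < e / 2 by rewrite divr_gt0.
have [d1 d10 H1] := strict_diff HR z e2.
have [d2 d20 H2] := strict_diff HI z e2.
exists (Num.min d1 d2); first by rewrite lt_min d10.
move=> h; rewrite lt_min => /andP[h1 h2].
have := H1 z h; rewrite subrr rnorm0 => /(_ d10 h1).
have := H2 z h; rewrite subrr rnorm0 => /(_ d20 h2).
have dy j : rderive (diry R j) g z = (0 +i* 1) * rderive (dirx R j) g z.
  have /eqP := CR j; rewrite /dzbar mulf_eq0 invr_eq0 pnatr_eq0/=.
  rewrite addr_eq0 => /eqP ->; rewrite mulrN mulrA -expr2 sqr_i mulN1r opprK//.
have lE : lform (fun j => rderive (dirx R j) g z) h =
    \sum_c (rcoord c h)%:C * rderive (rdir R c) g z.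
  rewrite (_ : \sum_c _ =
    \sum_j \sum_b (rcoord (b, j) h)%:C * rderive (rdir R (b, j)) g z); last first.
    by rewrite exchange_big pair_bigA; apply: eq_bigr => -[].
  apply: eq_bigr => j _; rewrite big_bool /rdir /rcoord /= dy.
  rewrite mulrA -mulrDl mulrC; congr (_ * _).
  by rewrite addrC mulrC -complexE.
have lR : complex.Re (lform (fun j => rderive (dirx R j) g z) h) =
    \sum_c rcoord c h * complex.Re (rderive (rdir R c) g z).
  rewrite lE Re_sum; apply: eq_bigr => c _.
  by case: (rderive _ _ _) => x y /=; rewrite mul0r subr0.
have lI : complex.Im (lform (fun j => rderive (dirx R j) g z) h) =
    \sum_c rcoord c h * complex.Im (rderive (rdir R c) g z).
  rewrite lE Im_sum; apply: eq_bigr => c _.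
  by case: (rderive _ _ _) => x y /=; rewrite mul0r addr0.
rewrite -lR -lI => KI KR; apply: le_trans (normc_le_ReIm _) _.
have -> : e * rnorm h = e / 2 * rnorm h + e / 2 * rnorm h by field.
move: KI KR; case: (lform _ _) => l1 l2; case: (g (z + h)) => a b.
by case: (g z) => a' b' /= KI KR; exact: lerD.
Qed.

End C1Calculus.

(** * The kernel of Delta consists of holomorphic functions *)
Section KernelIsHolomorphic.
Variables (R : realType) (n : nat) (nu : R).
Local Notation C := R[i].
Local Notation V := 'rV[R[i]]_n.
Local Notation I := (bool * 'I_n)%type.
Implicit Types (v w z h : V) (g : V -> C).

Lemma big_bool_ord (U : zmodType) (F : I -> U) :
  \sum_c F c = \sum_j (F (true, j) + F (false, j)).
Proof.
rewrite (_ : \sum_c _ = \sum_j \sum_b F (b, j)); last first.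
  by rewrite exchange_big pair_bigA; apply: eq_bigr => -[].
by apply: eq_bigr => j _; rewrite big_bool.
Qed.

Lemma Re_hdot z w : complex.Re (hdot z w) = \sum_c rcoord c z * rcoord c w.
Proof.
rewrite /hdot Re_sum big_bool_ord; apply: eq_bigr => j _.
rewrite /rcoord/=; case: (z 0 j) => a b; case: (w 0 j) => c d /=; ring.
Qed.

Lemma hdotDl z v w : hdot (z + v) w = hdot z w + hdot v w.
Proof.
by rewrite /hdot -big_split; apply: eq_bigr => j _; rewrite mxE mulrDl.
Qed.

Lemma hdotZl (a : C) v w : hdot (a *: v) w = a * hdot v w.
Proof.
by rewrite /hdot mulr_sumr; apply: eq_bigr => j _; rewrite mxE mulrA.
Qed.

Lemma hdot_dirx j w : hdot (dirx R j) w = conjc (w 0 j).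
Proof.
rewrite /hdot (bigD1 j)//= big1 => [|i ij]; rewrite mxE ?eqxx ?mul1r ?addr0//=.
by rewrite (negPf ij) mul0r.
Qed.

Lemma hdot_diry j w : hdot (diry R j) w = (0 +i* 1) * conjc (w 0 j).
Proof. by rewrite /diry hdotZl hdot_dirx. Qed.

Definition gauss z : R := expR (- nu * \sum_c rcoord c z * rcoord c z).

Lemma C1_gauss : C1 gauss (fun c z => - 2 * nu * rcoord c z * gauss z).
Proof.
have := C1_expR (C1Z (- nu) (C1_sum (index_enum I)
  (fun c => C1M (@C1_rcoord R n c) (@C1_rcoord R n c)))).
congr C1; apply/funext => d; apply/funext => z; rewrite /gauss mulrC.
congr (_ * _); rewrite (bigD1 d)//= eqxx big1 ?addr0 => [|c /negPf ->].
  by rewrite -[true%:R]/(1 : R); ring.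
by rewrite mulr0 addr0.
Qed.

Definition factor (chi : V -> C) w z : C :=
  chi w * expc ((nu / 2)%:C * hnormsq w + nu%:C * hdot z w).

(** |z + w|^2 = |z|^2 + |w|^2 + 2 Re <z, w>, and the last two terms, multiplied
    by nu, are the exponent of the squared modulus of the factor. *)
Lemma gauss_factor chi w z : normc (chi w) = 1 ->
  gauss (z + w) * normc (factor chi w z) ^+ 2 = gauss z.
Proof.
move=> chi1; rewrite normcM chi1 mul1r normc_expc -expRM_natl /gauss -expRD.
congr expR.
have -> : complex.Re ((nu / 2)%:C * hnormsq w + nu%:C * hdot z w) =
    nu / 2 * complex.Re (hnormsq w) + nu * complex.Re (hdot z w).
  by case: (hnormsq w) => ? ?; case: (hdot z w) => ? ? /=; rewrite !mul0r !subr0.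
rewrite /hnormsq !Re_hdot.
have -> : \sum_c rcoord c (z + w) * rcoord c (z + w) =
   \sum_c rcoord c z * rcoord c z + \sum_c rcoord c w * rcoord c w
     + 2 * \sum_c rcoord c z * rcoord c w.
  rewrite mulr_sumr -!big_split/=; apply: eq_bigr => c _; rewrite rcoordD; ring.
by field.
Qed.

Lemma curve_deriveM (phi psi : R -> C) (dp dq : C) :
  is_derive (0 : R) 1 (fun t => complex.Re (phi t)) (complex.Re dp) ->
  is_derive (0 : R) 1 (fun t => complex.Im (phi t)) (complex.Im dp) ->
  is_derive (0 : R) 1 (fun t => complex.Re (psi t)) (complex.Re dq) ->
  is_derive (0 : R) 1 (fun t => complex.Im (psi t)) (complex.Im dq) ->
  let d := dp * psi 0 + phi 0 * dq in
  is_derive (0 : R) 1 (fun t => complex.Re (phi t * psi t)) (complex.Re d) /\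
  is_derive (0 : R) 1 (fun t => complex.Im (phi t * psi t)) (complex.Im d).
Proof.
move=> hp1 hp2 hq1 hq2 d; split.
  have -> : (fun t => complex.Re (phi t * psi t)) =
    (fun t => complex.Re (phi t) * complex.Re (psi t)
              - complex.Im (phi t) * complex.Im (psi t)).
    by apply/funext => t; case: (phi t) => ? ?; case: (psi t).
  apply: (is_derive_eq (is_deriveB (is_deriveM hp1 hq1) (is_deriveM hp2 hq2))).
  rewrite /d /GRing.scale/=.
  case: (phi 0) => a b; case: (psi 0) => a' b'; case: dp {d hp1 hp2} => x y.
  by case: dq {hq1 hq2} => x' y' /=; ring.
have -> : (fun t => complex.Im (phi t * psi t)) =
  (fun t => complex.Re (phi t) * complex.Im (psi t)
            + complex.Im (phi t) * complex.Re (psi t)).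
  by apply/funext => t; case: (phi t) => ? ?; case: (psi t).
apply: (is_derive_eq (is_deriveD (is_deriveM hp1 hq2) (is_deriveM hp2 hq1))).
rewrite /d /GRing.scale/=.
case: (phi 0) => a b; case: (psi 0) => a' b'; case: dp {d hp1 hp2} => x y.
by case: dq {hq1 hq2} => x' y' /=; ring.
Qed.

Section Quasiperiodic.
Variables (Gamma : set V) (chi : V -> C) (g : V -> C).
Hypothesis g_qp : quasiperiodic nu Gamma chi g.
Hypothesis g_C1 : class_C 1 g.

(** Along t |-> z + t v the automorphy factor is multiplied by
    e^(t nu <v, w>), so the product rule gives the extra term. *)
Lemma quasiperiodic_rderive c z w : Gamma w ->
  rderive (rdir R c) g (z + w) = factor chi w z *
    (rderive (rdir R c) g z + nu%:C * hdot (rdir R c) w * g z).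
Proof.
move=> Gw; set ka := nu%:C * _.
have gE (t : R) : g (z + w + t%:C *: rdir R c) =
    (factor chi w z * expc (0 + ka * t%:C)) * g (z + t%:C *: rdir R c).
  rewrite (addrAC z w) (g_qp _ Gw); congr (_ * _); rewrite /factor -mulrA -expcD.
  by rewrite hdotDl hdotZl /ka; congr (_ * expc _); ring.
have Hphi : cderiv (fun s => factor chi w z * expc (0 + ka * s)) 0
    (factor chi w z * ka).
  have K := cderiv_comp (cderiv_affine 0 ka 0) (expc_cderiv (0 + ka * 0)).
  have := cderivM (cderiv_cst 0 (factor chi w z)) K.
  by rewrite mul0r add0r mulr0 addr0 expc0 mul1r.
have [D1 D2] := curve_deriveM (cderiv_Re Hphi) (cderiv_Im Hphi)
  ((class_C1_Re g_C1).1 c z) ((class_C1_Im g_C1).1 c z).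
have -> : rderive (rdir R c) g (z + w) =
  derive1 (fun t : R => complex.Re (factor chi w z * expc (0 + ka * t%:C) *
     g (z + t%:C *: rdir R c))) 0 +i*
  derive1 (fun t : R => complex.Im (factor chi w z * expc (0 + ka * t%:C) *
     g (z + t%:C *: rdir R c))) 0.
  by rewrite /rderive; congr (derive1 _ 0 +i* derive1 _ 0); apply/funext => t;
     rewrite gE.
rewrite !derive1E.
rewrite (@derive_val _ _ _ _ _ _ _ D1) (@derive_val _ _ _ _ _ _ _ D2).
rewrite mulr0 addr0 expc0 mulr1 scale0r addr0.
rewrite (_ : _ +i* _ = factor chi w z * ka * g z +
  factor chi w z * rderive (rdir R c) g z); first by ring.
by case: (_ + _).
Qed.

(** The factor is holomorphic in z: the extra terms of the derivatives along
    x_j and y_j differ by the factor i and cancel in dzbar. *)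
Lemma quasiperiodic_dzbar j z w : Gamma w ->
  dzbar j g (z + w) = factor chi w z * dzbar j g z.
Proof.
move=> Gw; rewrite /dzbar.
have := quasiperiodic_rderive (false, j) z Gw.
have := quasiperiodic_rderive (true, j) z Gw.
rewrite /rdir/= => -> ->; rewrite hdot_dirx hdot_diry.
have ii : (0 +i* 1) * (0 +i* 1) = -1 :> C by rewrite -expr2; exact: sqr_i.
set i := (0 +i* 1) in ii *; set k := conjc _; set F := factor _ _ _.
set a := rderive _ _ _; set b := rderive _ _ _.
rewrite (_ : _ + i * _ = F * (a + i * b) + (F * nu%:C * k * g z) * (1 + i * i));
  last by ring.
by rewrite ii subrr mulr0 addr0 mulrCA.
Qed.
End Quasiperiodic.

Lemma class_CW k g : class_C k.+1 g -> class_C k g.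
Proof.
elim: k g => [|k IH] g [cg Hg]; split; [exact: cg|by []|exact: cg|].
move=> j; have [hx hy cx cy] := Hg j.
by split; [exact: hx|exact: hy|exact: (IH _ cx)|exact: (IH _ cy)].
Qed.

(** Twice a summand of Delta g at z, for h = dzbar_j g with derivatives P + iQ
    along x_j and P' + iQ' along y_j, and s = 2 nu. *)
Lemma Delta_term_ReIm (s P P' Q Q' : R) (z h : C) :
  - (P +i* Q - (0 +i* 1) * (P' +i* Q')) + s%:C * (conjc z * h) =
  (- (P + Q') + s * (complex.Re z * complex.Re h + complex.Im z * complex.Im h))
  +i*
  (- (Q - P') + s * (complex.Re z * complex.Im h - complex.Im z * complex.Re h)).
Proof.
case: z => x y; case: h => a b; apply/eqP; rewrite eq_complex /=.
by apply/andP; split; apply/eqP; ring.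
Qed.

(** The weighted field conj(g) dzbar_j g is periodic with divergence
    2 e^(-nu |z|^2) sum_j |dzbar_j g|^2 >= 0; the equation Delta g = 0 removes
    the second-order terms of the divergence. *)
Lemma kernel_dzbar_eq0 (Gamma : set V) chi g : full_rank_lattice Gamma ->
  (forall w, Gamma w -> normc (chi w) = 1) ->
  quasiperiodic nu Gamma chi g -> class_C 2 g -> Delta nu g = (fun=> 0) ->
  forall j z, dzbar j g z = 0.
Proof.
move=> HG chi1 qp C2g Dg.
have C1g := class_CW C2g.
have Ha := class_C1_Re C1g; have Hb := class_C1_Im C1g.
set a := (fun z => complex.Re (g z)) in Ha.
set b := (fun z => complex.Im (g z)) in Hb.
set Da := (fun c z => _) in Ha; set Db := (fun c z => _) in Hb.
have [P [Q HPQ]] : exists P Q : 'I_n -> I -> V -> R, forall j,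
    C1 (fun z => complex.Re (dzbar j g z)) (P j) /\
    C1 (fun z => complex.Im (dzbar j g z)) (Q j).
  have /boolp.choice[PQ H] : forall j, exists PQ : (I -> V -> R) * (I -> V -> R),
    C1 (fun z => complex.Re (dzbar j g z)) PQ.1 /\
    C1 (fun z => complex.Im (dzbar j g z)) PQ.2.
    by move=> j; have [P [Q H]] := class_C1_dzbar j C2g; exists (P, Q).
  by exists (fun j => (PQ j).1), (fun j => (PQ j).2).
pose p j z := complex.Re (dzbar j g z); pose q j z := complex.Im (dzbar j g z).
(* With g = a + ib and dzbar_j g = p_j + i q_j, the components of X along x_j
   and y_j are the weight times Re and Im of conj(g) dzbar_j g. *)
pose X (c : I) z : R := gauss z *
  (if c.1 then a z * q c.2 z + -1 * (b z * p c.2 z)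
   else a z * p c.2 z + b z * q c.2 z).
pose DX (c : I) (d : I) z : R :=
  gauss z *
    (if c.1 then (a z * Q c.2 d z + q c.2 z * Da d z)
                 + -1 * (b z * P c.2 d z + p c.2 z * Db d z)
     else (a z * P c.2 d z + p c.2 z * Da d z) + (b z * Q c.2 d z + q c.2 z * Db d z))
  + (if c.1 then a z * q c.2 z + -1 * (b z * p c.2 z)
     else a z * p c.2 z + b z * q c.2 z) * (- 2 * nu * rcoord d z * gauss z).
have HX c : C1 (X c) (DX c).
  case: c => -[] j; have [HP HQ] := HPQ j.
    exact: (C1M C1_gauss (C1D (C1M Ha HQ) (C1Z (-1) (C1M Hb HP)))).
  exact: (C1M C1_gauss (C1D (C1M Ha HP) (C1M Hb HQ))).
have pE j z : 2 * p j z = Da (false, j) z - Db (true, j) z.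
  by rewrite /p dzbar_ReIm /Da /Db /rdir /= mulrA divff ?pnatr_eq0// mul1r mulN1r.
have qE j z : 2 * q j z = Db (false, j) z + Da (true, j) z.
  by rewrite /q dzbar_ReIm /Da /Db /rdir /= mulrA divff ?pnatr_eq0// mul1r.
(* Twice the real and imaginary parts of the j-th summand of Delta g. *)
pose T1 j z := - (P j (false, j) z + Q j (true, j) z)
  + 2 * nu * (rcoord (false, j) z * p j z + rcoord (true, j) z * q j z).
pose T2 j z := - (Q j (false, j) z - P j (true, j) z)
  + 2 * nu * (rcoord (false, j) z * q j z - rcoord (true, j) z * p j z).
have TE j z : 2 * (- dz j (dzbar j g) z + nu%:C * conjc (z 0 j) * dzbar j g z)
    = T1 j z +i* T2 j z.
  have [HP HQ] := HPQ j.
  have Rx : rderive (dirx R j) (dzbar j g) z = P j (false, j) z +i* Q j (false, j) z.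
    exact: (C1_rderive (false, j) z HP HQ).
  have Ry : rderive (diry R j) (dzbar j g) z = P j (true, j) z +i* Q j (true, j) z.
    exact: (C1_rderive (true, j) z HP HQ).
  rewrite /dz Rx Ry mulrDr mulrN mulrA divff ?pnatr_eq0// mul1r.
  have -> : 2 * (nu%:C * conjc (z 0 j) * dzbar j g z) =
      (2 * nu)%:C * (conjc (z 0 j) * dzbar j g z).
    by rewrite rmorphM rmorph_nat !mulrA.
  rewrite /T1 /T2 /p /q /rcoord /fst /snd.
  exact: Delta_term_ReIm.
have T0 z : \sum_j T1 j z = 0 /\ \sum_j T2 j z = 0.
  have E : \sum_j (T1 j z +i* T2 j z) = 0.
    under eq_bigr do rewrite -TE.
    rewrite -mulr_sumr; have := congr1 (fun F : V -> C => F z) Dg.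
    by rewrite /Delta => ->; rewrite mulr0.
  split; first by have := congr1 (@complex.Re R) E; rewrite Re_sum.
  by have := congr1 (@complex.Im R) E; rewrite Im_sum.
have divX z : \sum_c DX c c z = gauss z * \sum_j 2 * (p j z ^+ 2 + q j z ^+ 2).
  have [T10 T20] := T0 z.
  rewrite big_bool_ord.
  transitivity (gauss z * \sum_j 2 * (p j z ^+ 2 + q j z ^+ 2)
    - gauss z * (a z * \sum_j T1 j z + b z * \sum_j T2 j z)).
    rewrite !mulr_sumr -big_split/= mulr_sumr -sumrB; apply: eq_bigr => j _.
    rewrite /DX /T1 /T2 /=.
    have -> : 2 * (p j z ^+ 2 + q j z ^+ 2) =
       p j z * (Da (false, j) z - Db (true, j) z)
       + q j z * (Db (false, j) z + Da (true, j) z).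
      by rewrite -pE -qE; ring.
    (* The identity is polynomial in the values of the functions involved. *)
    move: (gauss z) (a z) (b z) (p j z) (q j z) => ? ? ? ? ?.
    move: (rcoord (false, j) z) (rcoord (true, j) z) => ? ?.
    move: (Da (false, j) z) (Da (true, j) z) => ? ?.
    move: (Db (false, j) z) (Db (true, j) z) => ? ?.
    move: (P j (false, j) z) (P j (true, j) z) => ? ?.
    move: (Q j (false, j) z) (Q j (true, j) z) => ? ?.
    by ring.
  by rewrite T10 T20 !mulr0 addr0 mulr0 subr0.
have Xper c w z : Gamma w -> X c (z + w) = X c z.
  move=> Gw; have XE y : X c y = gauss y *
      (if c.1 then complex.Im (conjc (g y) * dzbar c.2 g y)
       else complex.Re (conjc (g y) * dzbar c.2 g y)).
    rewrite /X /a /b /p /q; case: c.1; case: (g y) => ? ?;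
    by case: (dzbar _ _ _) => ? ? /=; congr (_ * _); ring.
  rewrite !XE (quasiperiodic_dzbar qp C1g c.2 z Gw) (qp z w Gw) -/(factor chi w z).
  rewrite -(gauss_factor z (chi1 w Gw)).
  have -> : conjc (factor chi w z * g z) * (factor chi w z * dzbar c.2 g z) =
     (normc (factor chi w z) ^+ 2)%:C * (conjc (g z) * dzbar c.2 g z).
    rewrite rmorphM rmorphXn/= -norm_normc sqr_normc; ring.
  rewrite -mulrA; congr (_ * _).
  by case: c.1; case: (_ * dzbar _ _ _) => ? ? /=; rewrite mul0r ?subr0 ?addr0.
have [e [Ge span]] := lattice_span HG.
have /boolp.choice[A HA] : forall c : I, exists A : 'I_(2 * n) -> R,
    rdir R c = \sum_i (A i)%:C *: e i by move=> c; exact: span.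
have f0 := @periodic_divergence_eq0 R n (2 * n) e A X DX HA HX
   (fun c i z => Xper c (e i) z (Ge i)).
have pq0 j z : 0 <= 2 * (p j z ^+ 2 + q j z ^+ 2).
  by rewrite mulr_ge0// addr_ge0// sqr_ge0.
move=> j z; have /eqP : \sum_c DX c c z = 0.
  apply: f0 => y; rewrite divX mulr_ge0 ?expR_ge0// sumr_ge0//.
rewrite divX mulf_eq0 gt_eqF ?expR_gt0//= psumr_eq0 => [/allP/(_ j)|i _//].
rewrite mem_index_enum => /(_ isT)/=.
rewrite mulf_eq0 pnatr_eq0/= paddr_eq0 ?sqr_ge0// !sqrf_eq0 => /andP[].
by rewrite /p /q; case: (dzbar j g z) => x y /= /eqP -> /eqP ->.
Qed.

End KernelIsHolomorphic.

Theorem mainTheorem3 (R : realType) (n : nat) (hn : (1 <= n)%N)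
    (nu : R) (hnu : 0 < nu)
    (Gamma : set 'rV[R[i]]_n) (hGamma : full_rank_lattice Gamma)
    (chi : 'rV[R[i]]_n -> R[i])
    (hchiU : forall w, Gamma w -> U1 (chi w))
    (hchi : forall w1 w2, Gamma w1 -> Gamma w2 ->
      chi (w1 + w2) = chi w1 * chi w2 * expc (0 +i* (nu * omega w1 w2))) :
  [set g | holomorphic g /\ quasiperiodic nu Gamma chi g] =
  [set g | Gspace nu Gamma chi g /\ Delta nu g = (fun=> 0)].
Proof.
apply/seteqP; split=> g /=.
  move=> [hg qp]; have Hg : entire g by move=> z; apply/differentiableP_cgrad.
  by split; [split=> // k; exact: entire_class_C|exact: entire_Delta].
move=> [[sg qp] Dg]; split=> // z; apply/differentiableP_cgrad.
apply: cauchy_riemann_cgrad; first exact: sg.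
move=> j; apply: (kernel_dzbar_eq0 hGamma _ qp (sg 2%N) Dg) => w /hchiU chi1.
by apply: complexI; rewrite -norm_normc; exact: chi1.
Qed.
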